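(* Let $H_7$ be the graph on vertex set $\{u,a,b,c,d,v,w\}$ in which $\{u,a,b,c,d\}$ induces a $K_5$, $\{w,a,b,c,d\}$ induces a $K_5$, $v$ is adjacent only to $u$, and $u,w$ are non-adjacent (so $H_7$ consists of two copies of $K_5$ sharing a $K_4$, plus a pendant vertex attached to one of the two vertices outside the shared $K_4$). Let $G$ be a finite simple graph with $\alpha(G) \leq 2$ that contains no induced subgraph isomorphic to $H_7$. Then $h(G) \geq \chi(G)$.
   Context: All graphs are finite, undirected and simple. $\alpha(G)$ is the independence number and $\chi(G)$ the chromatic number of $G$. $h(G)$ denotes the largest $t$ such that $G$ contains $K_t$ as a minor (a minor is obtained by a sequence of vertex deletions, edge deletions and edge contractions). *)

(* Defs.v *)
From HB Require Import structures.
From mathcomp Require Import all_boot.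
From mathcomp Require Import boolp.

Set Implicit Arguments.
Unset Strict Implicit.
Unset Printing Implicit Defensive.

Record sgraph := SGraph {
  svertex :> finType;
  sedge : rel svertex;
  sedge_sym : symmetric sedge;
  sedge_irrefl : irreflexive sedge
}.

Notation "x -- y" := (sedge x y) (at level 30, no associativity).

Definition isomorphic (G H : sgraph) : Prop :=
  exists2 f : G -> H, bijective f & forall x y : G, f x -- f y = x -- y.

Section Operations.
Variable G : sgraph.

Definition induced_rel (S : {set G}) : rel {x : G | x \in S} :=
  fun x y => val x -- val y.

Lemma induced_sym (S : {set G}) : symmetric (@induced_rel S).
Proof. by move=> x y; rewrite /induced_rel sedge_sym. Qed.

Lemma induced_irrefl (S : {set G}) : irreflexive (@induced_rel S).
Proof. by move=> x; rewrite /induced_rel sedge_irrefl. Qed.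

Definition induced (S : {set G}) : sgraph :=
  SGraph (@induced_sym S) (@induced_irrefl S).

Definition delete_vertex (x : G) : sgraph := induced [set~ x].

Definition delete_edge_rel (x y : G) : rel G :=
  fun z t => z -- t && ([set z; t] != [set x; y]).

Lemma delete_edge_sym (x y : G) : symmetric (delete_edge_rel x y).
Proof. by move=> z t; rewrite /delete_edge_rel sedge_sym setUC. Qed.

Lemma delete_edge_irrefl (x y : G) : irreflexive (delete_edge_rel x y).
Proof. by move=> z; rewrite /delete_edge_rel sedge_irrefl. Qed.

Definition delete_edge (x y : G) : sgraph :=
  SGraph (delete_edge_sym x y) (delete_edge_irrefl x y).

(* Contraction of the edge xy: y is removed, and x, which plays the role of
   the merged vertex, inherits the neighbours of y. *)
Definition contract_rel (x y : G) : rel {z : G | z \in [set~ y]} :=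
  fun z t => (z != t) &&
    [|| val z -- val t,
        (val z == x) && (y -- val t)
      | (val t == x) && (y -- val z)].

Lemma contract_sym (x y : G) : symmetric (@contract_rel x y).
Proof.
move=> z t; rewrite /contract_rel eq_sym (sedge_sym (val z)).
by congr (_ && (_ || _)); rewrite orbC.
Qed.

Lemma contract_irrefl (x y : G) : irreflexive (@contract_rel x y).
Proof. by move=> z; rewrite /contract_rel eqxx. Qed.

Definition contract (x y : G) : sgraph :=
  SGraph (@contract_sym x y) (@contract_irrefl x y).

End Operations.

Inductive minor_step (G : sgraph) : sgraph -> Prop :=
| MinorDelVertex (x : G) : minor_step G (delete_vertex x)
| MinorDelEdge (x y : G) : x -- y -> minor_step G (delete_edge x y)
| MinorContract (x y : G) : x -- y -> minor_step G (contract x y).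

(* [minor G H]: H is a minor of G, up to isomorphism. *)
Inductive minor : sgraph -> sgraph -> Prop :=
| MinorIso (G H : sgraph) : isomorphic G H -> minor G H
| MinorStep (G G' H : sgraph) : minor_step G G' -> minor G' H -> minor G H.

Section Complete.
Variable t : nat.

Definition complete_rel : rel 'I_t := fun i j => i != j.

Lemma complete_sym : symmetric complete_rel.
Proof. by move=> i j; rewrite /complete_rel eq_sym. Qed.

Lemma complete_irrefl : irreflexive complete_rel.
Proof. by move=> i; rewrite /complete_rel eqxx. Qed.

Definition complete : sgraph := SGraph complete_sym complete_irrefl.

End Complete.

Section Invariants.
Variable G : sgraph.

Definition independent (S : {set G}) : bool :=
  [forall x in S, forall y in S, ~~ (x -- y)].

Definition independence_number : nat :=
  \max_(S : {set G} | independent S) #|S|.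

Definition colorable (k : nat) : bool :=
  [exists f : {ffun G -> 'I_k}, forall x, forall y, (x -- y) ==> (f x != f y)].

Lemma ex_colorable : exists k, colorable k.
Proof.
exists #|G|; apply/existsP; exists [ffun x => enum_rank x].
apply/forallP=> x; apply/forallP=> y; apply/implyP=> xy; rewrite !ffunE.
apply: contraTneq xy => /enum_rank_inj ->.
by rewrite sedge_irrefl.
Qed.

Definition chromatic_number : nat := ex_minn ex_colorable.

End Invariants.

Lemma minor_step_card (G H : sgraph) : minor_step G H -> #|H| <= #|G|.
Proof. by case=> [x|x y _|x y _] //=; rewrite card_sig max_card. Qed.

Lemma minor_card (G H : sgraph) : minor G H -> #|H| <= #|G|.
Proof.
elim=> [{}G {}H [f f_bij _]|{}G G' {}H /minor_step_card le_G'G _ le_HG'].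
  by rewrite (bij_eq_card f_bij).
exact: leq_trans le_HG' le_G'G.
Qed.

Lemma minor_complete0 (G : sgraph) : minor G (complete 0).
Proof.
have [n] := ubnP #|G|; elim: n G => // n IHn G.
have [x _ leGn|G0 _] := pickP (@predT G).
  apply: (MinorStep (MinorDelVertex x)); apply: IHn.
  rewrite /= card_sig (@eq_card _ _ [set~ x]) // cardsC1.
  have: 0 < #|G| by apply/card_gt0P; exists x.
  by move: leGn; case: #|G|.
apply: MinorIso; have f (x : G) : 'I_0 by move: (G0 x).
exists f; last by move=> x; move: (G0 x).
by exists (fun i : 'I_0 => False_rect G (notF (ltn_ord i))) => [x|[]//]; move: (G0 x).
Qed.

Section Hadwiger.
Variable G : sgraph.

Lemma ex_complete_minor : exists t, `[< minor G (complete t) >].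
Proof. by exists 0; apply/asboolP; apply: minor_complete0. Qed.

Lemma complete_minor_bound (t : nat) : `[< minor G (complete t) >] -> t <= #|G|.
Proof. by move/asboolP/minor_card; rewrite card_ord. Qed.

Definition hadwiger_number : nat :=
  ex_maxn ex_complete_minor complete_minor_bound.

End Hadwiger.

(* u, a, b, c, d, v, w are encoded as 0, 1, 2, 3, 4, 5, 6; the graph is the
   union of the cliques {u,a,b,c,d}, {w,a,b,c,d} and {u,v}. *)
Definition H7_rel : rel 'I_7 := fun x y =>
  (x != y) &&
  has (fun K : seq nat => (val x \in K) && (val y \in K))
    [:: [:: 0; 1; 2; 3; 4]; [:: 6; 1; 2; 3; 4]; [:: 0; 5]].

Lemma H7_sym : symmetric H7_rel.
Proof.
move=> x y; rewrite /H7_rel eq_sym; congr (_ && _).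
by apply: eq_has => K; rewrite andbC.
Qed.

Lemma H7_irrefl : irreflexive H7_rel.
Proof. by move=> x; rewrite /H7_rel eqxx. Qed.

Definition H7 : sgraph := SGraph H7_sym H7_irrefl.

(* Main.v *)
Require Import Defs.
From mathcomp Require Import all_boot zify.

(** Work in the complement, which is triangle-free since alpha(G) <= 2.  In it, H_7 is a
    star K_(1,5) with one edge subdivided, so H_7-freeness says that two vertices with a
    common coneighbour have coneighbourhoods N(v), N(u) with |N(v) \ N(u)| <= 3.

    If k is the size of a maximum matching of the complement, G is (|G| - k)-colourable, and
    we show that K_(|G| - k) is a minor.  By induction and Gallai's lemma this reduces to a
    minor K_t with t = |G|/2 rounded up.  There, an edge of G whose two ends together see
    every other vertex can be split off as a branch set, so the complement may be assumed
    to have diameter 2.  Let x have maximum codegree D, let C be its coneighbourhood (a clique of G)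
    and Y the set of the other vertices.  If Y contains a coedge, its two ends have disjoint
    traces on C, each missing at most 3 elements, so D <= 6; double counting of the coedges
    between C and Y then bounds |Y|.  To the clique C one adds seagulls, that is coedges uv
    together with a vertex coadjacent to neither end: every other vertex is adjacent to u or
    v.  One seagull may use x.  The coneighbourhoods inside Y have at most 3 elements, and
    enough further seagulls are found there by a finite case analysis, unless the matching
    number of Y is so small that Y contains a large clique.  Only for D = 4 and |Y| >= 10 are
    there not enough vertices for seagulls; there the minor comes from a perfect matching of
    G - x whose edges pairwise touch. *)

Set Implicit Arguments.
Unset Strict Implicit.
Unset Printing Implicit Defensive.

(** * Branch sets and complete minors *)

Section BranchSets.
Variable G : sgraph.
Implicit Types (A B : {set G}) (Bs : seq {set G}).

(* Stated with cuts rather than paths, connectivity passes to contractions by pulling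
   the cut back. *)
Definition set_connected B : Prop :=
  forall (S : pred G) x y, x \in B -> y \in B -> S x -> ~~ S y ->
  exists z w, [/\ z \in B, w \in B, S z, ~~ S w & z -- w].

Definition touch A B := [exists x in A, exists y in B, x -- y].

(** The branch sets are the fibres of a partial labelling, hence disjoint by construction; [None]
    marks vertices to be deleted. The middle clause says that the fibres are connected. *)
Definition branch_labelling t (f : G -> option 'I_t) : Prop :=
  [/\ forall i, exists x, f x = Some i,
      forall i (S : pred G) x y,
        f x = Some i -> f y = Some i -> S x -> ~~ S y ->
        exists z w, [/\ f z = Some i, f w = Some i, S z, ~~ S w & z -- w]
    & forall i j, i != j ->
        exists x y, [/\ f x = Some i, f y = Some j & x -- y]].

(** Relative to a vertex set [A], so that models on disjoint sets combine and inductions run over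
    subsets of one graph. *)
Definition clique_model A t : Prop :=
  exists Bs, [/\ size Bs = t,
    forall B, B \in Bs -> [/\ B \subset A, B != set0 & set_connected B]
    & pairwise (fun B B' => [disjoint B & B'] && touch B B') Bs].

End BranchSets.

(** Induction on the order of [G]: an unlabelled vertex is deleted, an edge inside a fibre is
    contracted. Once the labelling is total and injective, [G] is itself complete. *)
Lemma branch_labelling_minor (G : sgraph) t (f : G -> option 'I_t) :
  branch_labelling f -> minor G (complete t).
Proof.
have [n] := ubnP #|G|; elim: n => // n IHn in G f *.
rewrite ltnS => leGn [fS fC fA].
have card_del (x : G) : #|{: {z : G | z \in [set~ x]}}| < n.
  rewrite card_sig (@eq_card _ _ [set~ x]) // cardsC1.
  have: 0 < #|G| by apply/card_gt0P; exists x.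
  by lia.
have [x /eqP fx|f_tot] := pickP (fun x => f x == None).
  apply: (MinorStep (MinorDelVertex x)).
  have lift z i : f z = Some i -> z \in [set~ x].
    by rewrite !inE => fz; apply: contra_eq_neq fz => ->; rewrite fx.
  apply: (IHn (delete_vertex x) (fun z => f (val z))); first exact: card_del.
  split=> [i|i S y z fy fz Sy Sz|i j ij].
  - by have [y fy] := fS i; exists (Sub y (lift _ _ fy)).
  - pose S' (u : G) := if insub u is Some u' then S u' else false.
    have S'E (u : delete_vertex x) : S' (val u) = S u by rewrite /S' valK.
    have [||u [w [fu fw Su Sw uw]]] := fC i S' _ _ fy fz; rewrite ?S'E //.
    exists (Sub u (lift _ _ fu)), (Sub w (lift _ _ fw)); split=> //.
      by rewrite -S'E.
    by rewrite -S'E.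
  - have [u [w [fu fw uw]]] := fA i j ij.
    by exists (Sub u (lift _ _ fu)), (Sub w (lift _ _ fw)).
have [[x y] /andP[/= xy /eqP fxy]|f_inj] :=
  pickP (fun p : G * G => (p.1 != p.2) && (f p.1 == f p.2)).
  case fx: (f x) => [i0|]; last by move: (f_tot x); rewrite fx.
  (* The cut that isolates [x] yields a neighbour [w] of [x] with the same label. *)
  have [||_ [w [_ fw /eqP-> wx xw]]] := fC i0 (pred1 x) x y fx _ (eqxx x).
  - by rewrite -fxy.
  - by rewrite /= eq_sym.
  move: wx => /= wx {y xy fxy}.
  apply: (MinorStep (MinorContract xw)).
  have xP : x \in [set~ w] by rewrite !inE eq_sym.
  pose x' : contract x w := Sub x xP.
  (* The contraction map: [insubd] sends [w], the one vertex outside the subtype, to the default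
     [x']. *)
  pose pr (z : G) : contract x w := insubd x' z.
  have prK z : pr (val z) = z by rewrite /pr valKd.
  have prw : val (pr w) = x by rewrite val_insubd !inE eqxx.
  have prE z : z != w -> val (pr z) = z by move=> zw; rewrite val_insubd !inE zw.
  have fpr z : f (val (pr z)) = f z.
    by have [->|zw] := eqVneq z w; [rewrite prw fx fw|rewrite prE].
  have pr_edge z u : z -- u -> pr z != pr u -> pr z -- pr u.
    move=> zu nzu; rewrite /= /contract_rel nzu /=.
    have [zw|zw] := eqVneq z w.
      have uw : u != w by apply: contraNneq nzu => ->; rewrite zw.
      rewrite zw in zu *; rewrite prw (prE u uw) eqxx; by rewrite zu orbT.
    have [uw|uw] := eqVneq u w; last by rewrite !prE // zu.
    rewrite uw in zu *; rewrite prw (prE z zw) eqxx; by rewrite (sedge_sym w z) zu !orbT.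
  apply: (IHn (contract x w) (fun z => f (val z))); first exact: card_del.
  split=> [i|i S y z fy fz Sy Sz|i j ij].
  - by have [y fy] := fS i; exists (pr y); rewrite fpr.
  - have [||u [v [fu fv Su Sv uv]]] := fC i (fun u => S (pr u)) _ _ fy fz.
    + by rewrite /= prK.
    + by rewrite /= prK.
    exists (pr u), (pr v); rewrite !fpr; split=> //; apply: pr_edge => //.
    by apply: contraNneq Sv => <-.
  - have [u [v [fu fv uv]]] := fA i j ij.
    exists (pr u), (pr v); rewrite !fpr; split=> //; apply: pr_edge => //.
    apply: contraNneq ij => e; apply/eqP; apply: Some_inj.
    by rewrite -fu -fv -(fpr u) -(fpr v) e.
have inj x y : f x = f y -> x = y.
  move=> fxy; apply/eqP; move: (f_inj (x, y)) => /=.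
  by rewrite fxy eqxx andbT => /negbFE.
have lab x : {i | f x = Some i}.
  by case: (f x) (f_tot x) => [i|] // _; exists i.
pose h x := sval (lab x); have hE x : f x = Some (h x) := svalP (lab x).
have gP (i : 'I_t) : exists x, f x == Some i.
  by have [x fx] := fS i; exists x; rewrite fx.
apply: MinorIso; exists h.
  exists (fun i => xchoose (gP i)) => [x|i].
    by apply: inj; rewrite [RHS]hE; apply/eqP/(xchooseP (gP (h x))).
  by apply: Some_inj; rewrite -hE; apply/eqP/(xchooseP (gP i)).
move=> x y; rewrite /= /complete_rel.
have [hxy|hxy] := eqVneq (h x) (h y) => /=.
  have -> : x = y by apply: inj; rewrite !hE hxy.
  by rewrite sedge_irrefl.
have [u [v [fu fv uv]]] := fA _ _ hxy.
by rewrite -hE in fu; rewrite -hE in fv; rewrite -(inj _ _ fu) -(inj _ _ fv) uv.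
Qed.

Lemma clique_model_minor (G : sgraph) (A : {set G}) t :
  clique_model A t -> minor G (complete t).
Proof.
move=> [Bs [<- BsA /(pairwiseP set0) BsP]].
pose f x := [pick i : 'I_(size Bs) | x \in nth set0 Bs i].
have sep (i j : 'I_(size Bs)) : i != j ->
  [disjoint nth set0 Bs i & nth set0 Bs j] && touch (nth set0 Bs i) (nth set0 Bs j).
  rewrite neq_ltn => /orP[ij|ij]; first by apply: BsP; rewrite // inE.
  rewrite disjoint_sym; have /andP[-> /=] := BsP _ _ (ltn_ord j) (ltn_ord i) ij.
  case/existsP=> x /andP[Bx /existsP[y /andP[By xy]]].
  apply/existsP; exists y; rewrite By; apply/existsP; exists x.
  by rewrite Bx sedge_sym.
have fP x (i : 'I_(size Bs)) : f x = Some i <-> x \in nth set0 Bs i.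
  rewrite /f; case: pickP => [j xj|/(_ i) xi]; last by rewrite xi.
  split=> [[<-] //|xi]; congr Some; apply/eqP; apply: contraTT xi => ji.
  by have /andP[/disjointFr->] := sep _ _ ji.
apply: (@branch_labelling_minor G _ f); split=> [i|i S x y|i j ij].
- have [_ /set0Pn[x xi] _] := BsA _ (mem_nth set0 (ltn_ord i)).
  by exists x; apply/fP.
- move=> /fP fx /fP fy Sx Sy.
  have [_ _ /(_ S x y fx fy Sx Sy)] := BsA _ (mem_nth set0 (ltn_ord i)).
  by case=> z [w [zi wi Sz Sw zw]]; exists z, w; split=> //; apply/fP.
- have /andP[_ /existsP[x /andP[xi /existsP[y /andP[yj xy]]]]] := sep _ _ ij.
  by exists x, y; split=> //; apply/fP.
Qed.

Section CliqueModels.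
Variable G : sgraph.
Implicit Types (A B K : {set G}) (t : nat) (x y z : G).

Lemma touchP A B :
  reflect (exists x y, [/\ x \in A, y \in B & x -- y]) (touch A B).
Proof.
apply: (iffP existsP) => [[x /andP[xA /existsP[y /andP[yB xy]]]]|[x [y [xA yB xy]]]].
  by exists x, y.
by exists x; rewrite xA; apply/existsP; exists y; rewrite yB.
Qed.

Lemma clique_model0 A : clique_model A 0.
Proof. by exists [::]. Qed.

Lemma clique_modelW A B t u :
  A \subset B -> u <= t -> clique_model A t -> clique_model B u.
Proof.
move=> AB ut [Bs [szBs BsA BsP]]; exists (take u Bs); split.
- by rewrite size_takel ?szBs.
- by move=> C /mem_take /BsA[CA C0 Cc]; split=> //; apply: subset_trans AB.
- exact: subseq_pairwise (take_subseq _ _) BsP.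
Qed.

Lemma clique_modelU A B t u :
  [disjoint A & B] ->
  (forall x y, x \in A -> y \in B -> x -- y) ->
  clique_model A t -> clique_model B u -> clique_model (A :|: B) (t + u).
Proof.
move=> dAB jAB [As [<- AsA AsP]] [Bs [<- BsB BsP]].
exists (As ++ Bs); split; first by rewrite size_cat.
- move=> C; rewrite mem_cat => /orP[/AsA|/BsB] [CAB C0 Cc]; split=> //.
    exact: subset_trans (subsetUl _ _).
  exact: subset_trans (subsetUr _ _).
- rewrite pairwise_cat AsP BsP !andbT; apply/allrelP => C D /AsA[CA C0 _] /BsB[DB D0 _].
  rewrite (disjointWl CA (disjointWr DB dAB)) /=.
  have [x xC] := set0Pn _ C0; have [y yD] := set0Pn _ D0.
  by apply/touchP; exists x, y; split=> //; apply: jAB; [apply: (subsetP CA)|apply: (subsetP DB)].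
Qed.

Lemma clique_model_add A B t :
  [disjoint A & B] -> B != set0 -> set_connected B ->
  (forall x, x \in A -> exists2 y, y \in B & x -- y) ->
  clique_model A t -> clique_model (A :|: B) t.+1.
Proof.
move=> dAB B0 Bc domB [As [<- AsA AsP]]; exists (B :: As); split=> //.
- move=> C; rewrite inE => /orP[/eqP->|/AsA[CA C0 Cc]]; split=> //.
    exact: subsetUr.
  exact: subset_trans (subsetUl _ _).
- rewrite /= AsP andbT; apply/allP => C /AsA[CA /set0Pn[x xC] _].
  rewrite disjoint_sym (disjointWl CA dAB) /=.
  have [y yB xy] := domB x (subsetP CA _ xC).
  by apply/touchP; exists y, x; rewrite sedge_sym.
Qed.

Lemma set_connected1 x : set_connected [set x].
Proof. by move=> S y z /set1P-> /set1P-> ->. Qed.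

Lemma set_connected2 x y : x -- y -> set_connected [set x; y].
Proof.
move=> xy S u v uB vB Su Sv.
case/set2P: uB Su => -> Su; case/set2P: vB Sv => -> Sv; rewrite ?Su // in Sv *.
  by exists x, y; rewrite !inE !eqxx orbT.
by exists y, x; rewrite !inE !eqxx orbT sedge_sym.
Qed.

Lemma set_connected3 x y z : z -- x -> z -- y -> set_connected [set x; y; z].
Proof.
move=> zx zy S u v uB vB Su Sv.
have [Sz|Sz] := boolP (S z).
  exists z, v; split=> //; first by rewrite !inE eqxx !orbT.
  move: vB Sv; rewrite !inE => /orP[/orP[]|] /eqP-> //; by rewrite Sz.
exists u, z; split=> //; first by rewrite !inE eqxx !orbT.
by move: uB Su; rewrite !inE sedge_sym => /orP[/orP[]|] /eqP-> //; rewrite (negPf Sz).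
Qed.

Lemma clique_model_clique K :
  {in K &, forall x y, x != y -> x -- y} -> clique_model K #|K|.
Proof.
move=> Kc; exists [seq [set x] | x <- enum K]; split.
- by rewrite size_map -cardE.
- move=> B /mapP[x]; rewrite mem_enum => xK ->; split; last exact: set_connected1.
    by rewrite sub1set.
  by apply/set0Pn; exists x; rewrite inE.
- rewrite pairwise_map; apply: (@sub_in_pairwise _ (mem K) (fun x y => x != y)).
  + move=> x y xK yK xy /=; rewrite disjoints1 inE xy /=.
    by apply/touchP; exists x, y; rewrite !inE !eqxx; split=> //; apply: Kc.
  + by apply/allP => x; rewrite mem_enum.
  + by rewrite -uniq_pairwise enum_uniq.
Qed.

End CliqueModels.

Ltac subset_tac :=
  apply/subsetP => ?; rewrite !inE; repeat case: (_ == _) => //=.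

(** * Matchings: exchange along alternating paths, and Dirac's condition *)

Section Matchings.
Variables (T : finType) (r : rel T).
Hypothesis r_sym : symmetric r.
Implicit Types (A B : {set T}) (u v w x y z : T).

(** Recursion on the number of edges replaces matchings as objects; vertices of [A] may stay
    uncovered. *)
Fixpoint matchable k A : bool :=
  if k is k'.+1
  then [exists x in A, [exists y in A :\ x, r x y && matchable k' (A :\ x :\ y)]]
  else true.

Lemma matchableSP k A :
  reflect (exists x y, [/\ x \in A, y \in A :\ x, r x y & matchable k (A :\ x :\ y)])
          (matchable k.+1 A).
Proof.
apply: (iffP existsP) => [[x /andP[xA /existsP[y /and3P[yA xy M]]]]|[x [y [xA yA xy M]]]].
  by exists x, y.
by exists x; rewrite xA; apply/existsP; exists y; rewrite yA xy.
Qed.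

Lemma matchable_sub k A B : A \subset B -> matchable k A -> matchable k B.
Proof.
elim: k A B => [|k IHk] A B AB //= /matchableSP[x [y [xA yA xy M]]].
apply/(matchableSP k); exists x, y; split=> //; first exact: (subsetP AB).
  exact: (subsetP (setSD [set x] AB)).
by apply: IHk M; do 2!apply: setSD.
Qed.

Lemma matchableW k l A : k <= l -> matchable l A -> matchable k A.
Proof.
elim: k l A => [|k IHk] [|l] A // kl /matchableSP[x [y [xA yA xy M]]].
by apply/matchableSP; exists x, y; split=> //; apply: IHk M.
Qed.

Lemma matchable_card k A : matchable k A -> k.*2 <= #|A|.
Proof.
elim: k A => [|k IHk] A // /matchableSP[x [y [xA yA xy /IHk]]].
by rewrite (cardsD1 x A) xA (cardsD1 y (A :\ x)) yA; lia.
Qed.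

Lemma matchable_exact k A :
  matchable k A -> exists B, [/\ B \subset A, #|B| = k.*2 & matchable k B].
Proof.
elim: k A => [|k IHk] A; first by exists set0; rewrite sub0set cards0.
case/matchableSP=> x [y [xA yA xy /IHk[B [BA cB MB]]]].
have xB : x \notin B by apply/negP => /(subsetP BA); rewrite !inE eqxx andbF.
have yB : y \notin B by apply/negP => /(subsetP BA); rewrite !inE eqxx.
move: (yA); rewrite !inE => /andP[yx yA'].
have xyB : x \notin y |: B by rewrite !inE negb_or eq_sym yx.
exists (x |: (y |: B)); split.
- rewrite !subUset !sub1set xA yA' /=.
  by apply: subset_trans BA _; rewrite !subDset; subset_tac.
- by rewrite !cardsU1 xyB yB cB doubleS.
- apply/matchableSP; exists x, y; rewrite !inE !eqxx yx !orbT; split=> //.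
  by rewrite setU1K // setU1K.
Qed.

Lemma matchable_add k A x y :
  r x y -> x \in A -> y \in A -> x != y -> matchable k (A :\ x :\ y) ->
  matchable k.+1 A.
Proof.
move=> xy xA yA nxy M; apply/matchableSP; exists x, y; split=> //.
by rewrite !inE eq_sym nxy.
Qed.

(** The definition exposes an arbitrary edge of the matching; this brings the edge at a chosen
    vertex to the front, if there is one. *)
Lemma matchable_split k A v : v \in A -> matchable k.+1 A ->
  matchable k.+1 (A :\ v) \/ exists y, [/\ y \in A :\ v, r v y & matchable k (A :\ v :\ y)].
Proof.
elim: k A => [|k IHk] A vA /matchableSP[x [y [xA yA xy M]]];
  move: (yA); rewrite !inE => /andP[yx yA'];
  (have [vx|vx] := eqVneq v x; first by right; exists y; rewrite vx);
  (have [vy|vy] := eqVneq v y;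
     first by right; exists x; rewrite vy !inE xA eq_sym yx r_sym; split=> //;
       apply: matchable_sub M; subset_tac).
  by left; apply/matchableSP; exists x, y; rewrite !inE xA yA' yx ![_ == v]eq_sym vx vy.
have vA' : v \in A :\ x :\ y by rewrite !inE vx vy.
have [M'|[z [zA vz M']]] := IHk _ vA' M; [left|right].
  apply: (matchable_add xy).
  - by rewrite !inE xA eq_sym vx.
  - by rewrite !inE yA' eq_sym vy.
  - by rewrite eq_sym.
  by apply: matchable_sub M'; subset_tac.
move: zA; rewrite !inE => /and4P[zv zy zx zA].
exists z; rewrite !inE zv zA; split=> //.
apply: (matchable_add xy).
- by rewrite !inE xA ![x == _]eq_sym zx vx.
- by rewrite !inE yA' ![y == _]eq_sym zy vy.
- by rewrite eq_sym.
- by apply: matchable_sub M'; subset_tac.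
Qed.

Lemma matchableU k l A B : [disjoint A & B] ->
  matchable k A -> matchable l B -> matchable (k + l) (A :|: B).
Proof.
elim: k A => [|k IHk] A dAB; first by move=> _; apply: matchable_sub (subsetUr _ _).
case/matchableSP=> x [y [xA yA xy M]] MB; rewrite addSn.
move: yA; rewrite !inE => /andP[yx yA].
have xB : x \notin B by rewrite (disjointFr dAB).
have yB : y \notin B by rewrite (disjointFr dAB).
apply: (matchable_add xy); rewrite ?inE ?xA ?yA // 1?eq_sym //.
have dAB' : [disjoint A :\ x :\ y & B].
  by apply: disjointWl dAB; subset_tac.
apply: matchable_sub (IHk _ dAB' M MB).
apply/subsetP => z; rewrite !inE => /orP[/and3P[-> -> ->] //|zB].
by rewrite zB orbT andbT; apply/andP; split; apply: contraTneq zB => ->.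
Qed.

(* Follow the alternating path from v: its first two edges v-y (in the matching
   missing u and w) and y-z (in the one missing v) reduce the claim to the graph
   without v and y, with z playing the role of v. *)
Lemma matchable_exchange k A u v w :
  u \in A -> w \in A -> v \in A -> u != v -> w != v -> u != w ->
  matchable k (A :\ u :\ w) -> matchable k (A :\ v) -> ~~ matchable k.+1 A ->
  matchable k (A :\ v :\ u) \/ matchable k (A :\ v :\ w).
Proof.
elim: k A v => [|k IHk] A v uA wA vA uv wv uw MM MN nM; first by left.
have vB : v \in A :\ u :\ w by rewrite !inE ![v == _]eq_sym wv uv.
have [M'|[y [yB vy M']]] := matchable_split vB MM.
  by left; apply: matchable_sub M'; subset_tac.
move: yB; rewrite !inE => /and4P[yv yw yu yA].
have yA' : y \in A :\ v by rewrite !inE yv.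
(* If [y] were avoidable too, adding the edge from [v] to [y] would exceed the maximum. *)
have [M2|[z [zA yz M2]]] := matchable_split yA' MN.
  case/negP: nM; apply: (matchable_add vy) => //; by rewrite eq_sym.
move: zA; rewrite !inE => /and3P[zy zv zA].
(* The path has reached [u]: its last edge and the matching [M'] together miss [v] and [w]. Reaching
   [w] is symmetric. *)
have [zu|zu] := eqVneq z u.
  right; apply: (matchable_add yz); rewrite ?inE ?yA ?yw ?yv ?zA ?zv ?zu ?uw ?(eq_sym y) //.
    by rewrite -zu.
  by apply: matchable_sub M'; subset_tac.
have [zw|zw] := eqVneq z w.
  left; apply: (matchable_add yz); rewrite ?inE ?yA ?yu ?yv ?zA ?zv ?zu ?(eq_sym y) //.
  by apply: matchable_sub M'; rewrite zw; subset_tac.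
have step t : z != t -> y != t ->
    matchable k (A :\ v :\ y :\ z :\ t) -> matchable k.+1 (A :\ v :\ t).
  move=> zt yt M3; apply: (matchable_add yz).
  - by rewrite !inE yt yv yA.
  - by rewrite !inE zt zv zA.
  - by rewrite eq_sym.
  - by apply: matchable_sub M3; subset_tac.
have [|||||||M3|M3] := IHk (A :\ v :\ y) z _ _ _ _ _ uw _ M2.
- by rewrite !inE (eq_sym u y) yu uv.
- by rewrite !inE (eq_sym w y) yw wv.
- by rewrite !inE zy zv.
- by rewrite eq_sym.
- by rewrite eq_sym.
- by apply: matchable_sub M'; subset_tac.
- apply: contra nM => M3; apply: (matchable_add vy) => //; by rewrite eq_sym.
- by left; apply: step.
- by right; apply: step.
Qed.

Lemma matchable_max A : exists2 k, matchable k A & ~~ matchable k.+1 A.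
Proof.
have ex0 : exists k, matchable k A by exists 0.
have ub k : matchable k A -> k <= #|A| by move/matchable_card; lia.
case: (ex_maxnP ex0 ub) => k Mk kmax; exists k => //.
by apply/negP => /kmax; rewrite ltnn.
Qed.

(** If a matching edge [pq] can be exchanged for [up] and [vq], or for [uq] and [vp], this is done.
    Otherwise at most two of the adjacencies counted go to [pq], and the bound survives its
    removal. *)
Lemma matchable_ore_step k A u v :
  u \notin A -> v \notin A -> u != v -> #|A| = k.*2 -> matchable k A ->
  k.*2 < #|[set x in A | r u x]| + #|[set x in A | r v x]| ->
  matchable k.+1 (u |: (v |: A)).
Proof.
elim: k A => [|k IHk] A uA vA uv cA M.
  have A0 t : [set x in A | r t x] = set0.
    by apply/setP => x; rewrite !inE (cards0_eq cA) inE.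
  by rewrite !A0 cards0.
case/matchableSP: M => p [q [pA qA pq M]].
have cA' : #|A :\ p :\ q| = k.*2.
  by move: cA; rewrite (cardsD1 p A) pA (cardsD1 q (A :\ p)) qA; lia.
have split_card t : #|[set x in A | r t x]| = r t p + r t q + #|[set x in A :\ p :\ q | r t x]|.
  rewrite (cardsD1 p) (cardsD1 q) !inE pA; move: qA; rewrite !inE => /andP[-> ->] /=.
  by rewrite addnA; congr (_ + _); apply: eq_card => x; rewrite !inE; do 2!case: (_ == _).
rewrite !split_card => deg.
move: qA; rewrite !inE => /andP[qp qA].
have pu : p != u by apply: contraNneq uA => <-.
have pv : p != v by apply: contraNneq vA => <-.
have qu : q != u by apply: contraNneq uA => <-.
have qv : q != v by apply: contraNneq vA => <-.
have cross a b : r u a -> r v b -> a != b -> a \in A -> b \in A ->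
    A :\ p :\ q \subset A :\ a :\ b -> matchable k.+2 (u |: (v |: A)).
  move=> ua vb ab aA bA sub.
  have au : a != u by apply: contraNneq uA => <-.
  have av : a != v by apply: contraNneq vA => <-.
  have bu : b != u by apply: contraNneq uA => <-.
  have bv : b != v by apply: contraNneq vA => <-.
  apply: (matchable_add ua).
  - by rewrite !inE eqxx.
  - by rewrite !inE aA !orbT.
  - by rewrite eq_sym.
  apply: (matchable_add vb).
  - by rewrite !inE eqxx !orbT ![v == _]eq_sym av uv.
  - by rewrite !inE bA !orbT bu ![b == _]eq_sym ab.
  - by rewrite eq_sym.
  apply: matchable_sub M; apply: (subset_trans sub).
  apply/subsetP => t; rewrite !inE => /and3P[tb ta tA]; rewrite tb ta tA !orbT !andbT /=.
  by apply/andP; split; [apply: contraNneq vA|apply: contraNneq uA] => <-.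
have [/andP[up vq]|n1] := boolP (r u p && r v q).
  by apply: (cross p q) => //; rewrite eq_sym.
have [/andP[uq vp]|n2] := boolP (r u q && r v p).
  by apply: (cross q p) => //; subset_tac.
apply: (matchable_add pq); rewrite ?inE ?pA ?qA ?orbT // 1?eq_sym //.
have uA' : u \notin A :\ p :\ q by rewrite !inE (negPf uA) !andbF.
have vA' : v \notin A :\ p :\ q by rewrite !inE (negPf vA) !andbF.
apply: matchable_sub (IHk _ uA' vA' uv cA' M _).
  apply/subsetP => t; rewrite !inE => /or3P[/eqP->|/eqP->|/and3P[-> -> ->]].
  - by rewrite eqxx ![u == _]eq_sym pu qu.
  - by rewrite eqxx ![v == _]eq_sym pv qv !orbT.
  - by rewrite !orbT.
move: deg n1 n2; move: #|_| #|_| => du dv; clear.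
by case: (r u p); case: (r u q); case: (r v p); case: (r v q) => //=; lia.
Qed.

(** Dirac's condition. Two adjacent uncovered vertices extend the matching at once. Otherwise two
    uncovered vertices send all their edges, at least 2p > 2j in number, into the 2j covered
    vertices, and [matchable_ore_step] applies. *)
Lemma matchable_ore A p :
  #|A| = p.*2 -> (forall u, u \in A -> p <= #|[set x in A | r u x]|) ->
  irreflexive r -> matchable p A.
Proof.
move=> cA degA irr.
have: forall j, j <= p -> exists B, [/\ B \subset A, #|B| = j.*2 & matchable j B].
  elim=> [|j IHj] jp; first by exists set0; rewrite sub0set cards0.
  have [B [BA cB MB]] := IHj (ltnW jp).
  have cD : #|A :\: B| = p.*2 - j.*2 by rewrite cardsD (setIidPr BA) cA cB.
  have [u uD] : exists u, u \in A :\: B.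
    by apply/set0Pn; rewrite -card_gt0 cD; lia.
  have [v vD] : exists v, v \in (A :\: B) :\ u.
    by apply/set0Pn; rewrite -card_gt0; move: cD; rewrite (cardsD1 u) uD; lia.
  have addB x y : x \in A :\: B -> y \in A :\: B -> x != y ->
      matchable j.+1 (x |: (y |: B)) ->
      exists B', [/\ B' \subset A, #|B'| = j.+1.*2 & matchable j.+1 B'].
    rewrite !inE => /andP[xB xA] /andP[yB yA] xy M; exists (x |: (y |: B)).
    split=> //; first by rewrite !subUset !sub1set xA yA BA.
    by rewrite !cardsU1 !inE negb_or xy xB yB cB doubleS.
  move: (vD); rewrite in_setD1 => /andP[vu vD'].
  have [[x y] /= /and3P[xD yD xy]|none] :=
    pickP (fun q : T * T => [&& q.1 \in A :\: B, q.2 \in A :\: B & r q.1 q.2]).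
    have nxy : x != y by apply: contraTneq xy => ->; rewrite irr.
    apply: (addB x y) => //.
    apply: (matchable_add xy); rewrite ?inE ?eqxx ?orbT //.
    apply: matchable_sub MB; apply/subsetP => t tB; rewrite !inE tB !orbT andbT.
    by apply/andP; split; [move: yD|move: xD]; rewrite !inE => /andP[h _];
       apply: contraNneq h => <-.
  have inB x : x \in A :\: B -> #|[set y in A | r x y]| = #|[set y in B | r x y]|.
    move=> xD; apply: eq_card => y; rewrite !inE.
    have := none (x, y); rewrite /= xD !inE /=.
    by have := subsetP BA y; case: (y \in B) => [->//|_]; case: (y \in A).
  apply: (addB u v) => //; first by rewrite eq_sym.
  move: (uD) (vD'); rewrite !inE => /andP[uB uA] /andP[vB vA].
  apply: matchable_ore_step => //; first by rewrite eq_sym.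
  rewrite -!inB //; move: (degA u uA) (degA v vA) jp; clear; lia.
case/(_ p (leqnn p)) => B [BA cB MB]; exact: matchable_sub MB.
Qed.

End Matchings.

(* A list in [pack re rn s] consists of s triples (i, j, k), where ij is an edge
   and k is adjacent to neither i nor j, followed by the two ends of an edge. *)
Fixpoint pack (T : Type) (re rn : rel T) s (q : seq T) : bool :=
  match s, q with
  | 0, [:: i; j] => re i j
  | s'.+1, [:: i, j, k & q'] => [&& re i j, rn k i, rn k j & pack re rn s' q']
  | _, _ => false
  end.

(* Case distinctions on the adjacency of the vertices 0, ..., n - 1 of a
   triangle-free graph of maximum degree at most D; [Full] closes a branch where
   the graph is known to be D-regular.  The trees used below come from a computer
   search. *)
Inductive tree :=
  | Br (i j : nat) (yes no : tree)
  | Tri (i j k : nat)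
  | Deg (i : nat) (l : seq nat)
  | Pk (q : seq nat)
  | Full.

(** * Checking case distinctions on small graphs *)

Section Certificates.
Variables (n D s : nat) (regular_ok : bool).

Definition known (E : seq (nat * nat)) : rel nat :=
  fun i j => ((i, j) \in E) || ((j, i) \in E).

(** [E] and [N] list the pairs decided to be edges and non-edges. A leaf other than [Full] names a
    triangle, a vertex with D + 1 neighbours, or a packing that uses decided pairs only. *)
Fixpoint check (E N : seq (nat * nat)) (t : tree) : bool :=
  match t with
  | Br i j yes no => check ((i, j) :: E) N yes && check E ((i, j) :: N) no
  | Tri i j k => [&& known E i j, known E j k & known E i k]
  | Deg i l => [&& uniq l, size l == D.+1, all (gtn n) (i :: l) & all (known E i) l]
  | Pk q => [&& uniq q, all (gtn n) q & pack (known E) (known N) s q]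
  | Full => regular_ok &&
      all (fun i => D <= count (known E i) (iota 0 n)) (iota 0 n)
  end.

Variables (T : eqType) (r : rel T) (x0 : T) (vs : seq T).
Hypothesis r_sym : symmetric r.
Hypothesis r_tri : forall x y z, r x y -> r y z -> ~~ r x z.
Hypothesis uniq_vs : uniq vs.
Hypothesis size_vs : size vs = n.
Hypothesis deg_vs : {in vs, forall x, count (r x) vs <= D}.

Let v := nth x0 vs.

(** The graph decides every [Br] and so leads to one leaf; [Tri] and [Deg] contradict the
    hypotheses, [Pk] and [Full] give the two conclusions. *)
Lemma check_sound E N t :
  {in E, forall p, r (v p.1) (v p.2)} -> {in N, forall p, ~~ r (v p.1) (v p.2)} ->
  check E N t ->
  (exists q, [/\ uniq q, {subset q <= vs} & pack r (fun x y => ~~ r x y) s q])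
  \/ regular_ok /\ {in vs, forall x, D <= count (r x) vs}.
Proof.
have knownE E' i j : {in E', forall p, r (v p.1) (v p.2)} -> known E' i j -> r (v i) (v j).
  by move=> E'P /orP[/E'P|/E'P] //=; rewrite r_sym.
have knownN N' i j : {in N', forall p, ~~ r (v p.1) (v p.2)} -> known N' i j -> ~~ r (v i) (v j).
  by move=> N'P /orP[/N'P|/N'P] //=; rewrite r_sym.
have v_uniq l : uniq l -> all (gtn n) l -> uniq (map v l).
  move=> ul /allP ln; rewrite map_inj_in_uniq // => i j /ln /= li /ln /= lj /eqP.
  by rewrite nth_uniq ?size_vs // => /eqP.
have v_sub l : all (gtn n) l -> {subset map v l <= vs}.
  by move=> /allP ln _ /mapP[i /ln /= li ->]; apply: mem_nth; rewrite size_vs.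
elim: t E N => [i j yes IHy no IHn|i j k|i l|q|] E N EP NP /=.
- case/andP=> Cy Cn; have [ij|ij] := boolP (r (v i) (v j)).
    by apply: IHy Cy => // p; rewrite inE => /orP[/eqP->|/EP].
  by apply: IHn Cn => // p; rewrite inE => /orP[/eqP->|/NP].
- case/and3P=> /(knownE _ _ _ EP) ij /(knownE _ _ _ EP) jk /(knownE _ _ _ EP).
  by rewrite (negPf (r_tri ij jk)).
- case/and4P=> ul /eqP sl /andP[i_n ln] /allP lE.
  have vi : v i \in vs by apply: mem_nth; rewrite size_vs.
  have := deg_vs vi; rewrite leqNgt -sl -(size_map v) -size_filter.
  rewrite uniq_leq_size ?v_uniq // => x xl; rewrite mem_filter (v_sub l ln) // andbT.
  by case/mapP: xl => j /lE ij ->; apply: knownE ij.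
- case/and3P=> uq qn Pq; left; exists (map v q).
  split; [exact: v_uniq|exact: v_sub|].
  elim: s q Pq {uq qn} => [|s' IHs] [|i [|j [|k q]]] //=; first exact: knownE.
  case/and4P=> /(knownE _ _ _ EP)-> /(knownN _ _ _ NP)-> /(knownN _ _ _ NP)->.
  exact: IHs.
- case/andP=> rok /allP full; right; split=> // x xvs.
  have xi := xvs; rewrite -index_mem size_vs in xi.
  have := full (index x vs); rewrite mem_iota xi => /(_ isT) /leq_trans; apply.
  rewrite -{2}(mkseq_nth x0 vs) size_vs count_map; apply: sub_count => j /=.
  by move/(knownE _ _ _ EP); rewrite /v nth_index.
Qed.

End Certificates.

Ltac perm_tac := apply/permP => ? /=; clear; lia.

(** * Seagull packings in small triangle-free graphs *)

Section SeagullPacking.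
Variables (T : finType) (e : rel T).
Hypothesis e_sym : symmetric e.
Hypothesis e_tri : forall x y z, e x y -> e y z -> ~~ e x z.
Variable Y : {set T}.
Implicit Types (s : nat).

(** The final edge will form one more seagull with the vertex [x] outside [Y], so [has_pack s]
    stands for s + 1 branch sets. *)
Definition has_pack s : Prop :=
  exists q, [/\ uniq q, {subset q <= Y} & pack e (fun x y => ~~ e x y) s q].

Lemma count_le_deg vs y :
  uniq vs -> {subset vs <= Y} -> count (e y) vs <= #|[set z in Y | e y z]|.
Proof.
move=> uvs vsY; rewrite -size_filter -(card_uniqP (filter_uniq _ uvs)).
apply: subset_leq_card; apply/subsetP => z.
by rewrite mem_filter !inE => /andP[-> /vsY->].
Qed.

Let pack_check D s regular_ok E N t a vs :
  uniq vs -> {subset vs <= Y} ->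
  {in Y, forall y, #|[set z in Y | e y z]| <= D} ->
  {in E, forall p, e (nth a vs p.1) (nth a vs p.2)} ->
  {in N, forall p, ~~ e (nth a vs p.1) (nth a vs p.2)} ->
  check (size vs) D s regular_ok E N t ->
  has_pack s \/ regular_ok /\ {in vs, forall y, D <= count (e y) vs}.
Proof.
move=> uvs vsY degY EP NP Ct.
have deg_vs : {in vs, forall y, count (e y) vs <= D}.
  by move=> y /vsY yY; apply: leq_trans (count_le_deg y uvs vsY) (degY y yY).
have [[q [uq qvs Pq]]|] := check_sound e_sym e_tri uvs erefl deg_vs EP NP Ct.
  by left; exists q; split=> // y /qvs /vsY.
by right.
Qed.

(** Certificates refer to numbered vertices, so the matching and [n] spare vertices are laid out in
    lists. *)
Lemma matching_list k : matchable e k Y -> forall n, k.*2 + n <= #|Y| ->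
  exists l ws, [/\ size l = k, size ws = n,
    uniq (flatten [seq [:: p.1; p.2] | p <- l] ++ ws),
    {subset flatten [seq [:: p.1; p.2] | p <- l] ++ ws <= Y}
    & all (fun p => e p.1 p.2) l].
Proof.
elim: k Y => [|k IHk] Z; last first.
  case/matchableSP=> x [y [xZ yZ xy M]] n le_n.
  have [|l [ws [sl sws ul lZ el]]] := IHk _ M n.
    by move: le_n; rewrite (cardsD1 x Z) xZ (cardsD1 y (Z :\ x)) yZ; lia.
  exists ((x, y) :: l), ws; rewrite /= sl sws xy el ul; split=> //.
    rewrite inE negb_or andbT.
    have xl : x \notin flatten [seq [:: p.1; p.2] | p <- l] ++ ws.
      by apply/negP => /lZ; rewrite !inE eqxx andbF.
    have yl : y \notin flatten [seq [:: p.1; p.2] | p <- l] ++ ws.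
      by apply/negP => /lZ; rewrite !inE eqxx.
    by rewrite xl yl !andbT; move: yZ; rewrite !inE eq_sym => /andP[].
  move=> z; rewrite !inE => /or3P[/eqP->//|/eqP->|/lZ].
    by move: yZ; rewrite !inE => /andP[].
  by rewrite !inE => /and3P[].
move=> _ n le_n; exists [::], (take n (enum Z)); split=> //=.
- by rewrite size_takel // -cardE.
- by rewrite take_uniq // enum_uniq.
- by move=> z /mem_take; rewrite mem_enum.
Qed.

(* A vertex sees at most one end of an edge, which we may call the first one. *)
Let orient w a b : e a b ->
  exists a' b', [/\ e a' b', ~~ e w b', perm_eq [:: a; b] [:: a'; b']
                 & e w a' = e w a || e w b].
Proof.
move=> ab; have [wb|wb] := boolP (e w b); last by exists a, b; rewrite orbF.
have ba : e b a by rewrite e_sym.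
exists b, a; rewrite ba (e_tri wb ba) wb orbT; split=> //.
by perm_tac.
Qed.

(** The exception is the 5-cycle, the only 2-regular triangle-free graph on five vertices. *)
Lemma has_pack1_5 :
  #|Y| = 5 -> {in Y, forall y, #|[set z in Y | e y z]| <= 2} -> matchable e 2 Y ->
  has_pack 1 \/ {in Y, forall y, 2 <= #|[set z in Y | e y z]|}.
Proof.
move=> cY degY M; have cY5 : 2.*2 + 1 <= #|Y| by rewrite cY.
have [l [ws [sl sws]]] := matching_list M cY5.
case: l sl => [|[a b] [|[c d] []]] // _; case: ws sws => [|w []] // _ U S /and3P[/= ab cd _].
have [a' [b' [ab' wb pab _]]] := orient w ab.
have [c' [d' [cd' wd pcd _]]] := orient w cd.
have p : perm_eq [:: a; b; c; d; w] [:: a'; b'; c'; d'; w].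
  by rewrite -[[:: a, b & _]]/([:: a; b] ++ [:: c; d] ++ [:: w])
             -[[:: a', _ & _]]/([:: a'; b'] ++ [:: c'; d'] ++ [:: w]) !perm_cat.
have uvs : uniq [:: a'; b'; c'; d'; w] by rewrite -(perm_uniq p).
have vsY : {subset [:: a'; b'; c'; d'; w] <= Y}.
  by move=> z; rewrite -(perm_mem p); apply: S.
(* Positions 0 to 4 are [a'], [b'], [c'], [d'], [w]; the orientation makes [w] miss [b'] and
   [d']. *)
have [|||hp|[_ reg]] := @pack_check 2 1 true [:: (0, 1); (2, 3)] [:: (1, 4); (3, 4)]
  (Br 2 4 (Br 0 4 (Br 1 3 Full (Br 0 3 (Deg 0 [:: 1; 3; 4]) (Pk [:: 0; 1; 3;
   2; 4]))) (Pk [:: 0; 1; 4; 2; 3])) (Pk [:: 2; 3; 4; 0; 1]))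
  a' _ uvs vsY degY.
- by move=> q; rewrite !inE => /orP[]/eqP->.
- by move=> q; rewrite !inE => /orP[]/eqP-> /=; rewrite e_sym.
- by [].
- by left.
- right=> y yY; apply: leq_trans (count_le_deg y uvs vsY); apply: reg.
  have /subset_leqif_card : [set z in [:: a'; b'; c'; d'; w]] \subset Y.
    by apply/subsetP => z; rewrite inE => /vsY.
  have -> : #|[set z in [:: a'; b'; c'; d'; w]]| = 5.
    by rewrite cardsE; apply/card_uniqP.
  by rewrite cY => -[_ /esym/subsetP/(_ y yY)]; rewrite inE.
Qed.

(** The exception is K_{3,3}, where every vertex sees an end of every edge. *)
Lemma has_pack1_6 :
  6 <= #|Y| -> {in Y, forall y, #|[set z in Y | e y z]| <= 3} -> matchable e 2 Y ->
  has_pack 1 \/ #|Y| = 6 /\ {in Y, forall y, 3 <= #|[set z in Y | e y z]|}.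
Proof.
move=> cY degY M.
have [l [ws [sl sws]]] := matching_list M (cY : 2.*2 + 2 <= _).
case: l sl => [|[a b] [|[c d] []]] // _; case: ws sws => [|w [|w' []]] // _ U S /and3P[/= ab cd _].
have [a' [b' [ab' wb pab _]]] := orient w ab.
have [c' [d' [cd' wd pcd _]]] := orient w cd.
have p : perm_eq [:: a; b; c; d; w; w'] [:: a'; b'; c'; d'; w; w'].
  by rewrite -[[:: a, b & _]]/([:: a; b] ++ [:: c; d] ++ [:: w; w'])
             -[[:: a', _ & _]]/([:: a'; b'] ++ [:: c'; d'] ++ [:: w; w']) !perm_cat.
have uvs : uniq [:: a'; b'; c'; d'; w; w'] by rewrite -(perm_uniq p).
have vsY : {subset [:: a'; b'; c'; d'; w; w'] <= Y}.
  by move=> z; rewrite -(perm_mem p); apply: S.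
have [|||hp|[_ reg]] := @pack_check 3 1 true [:: (0, 1); (2, 3)] [:: (1, 4); (3, 4)]
  (Br 2 4 (Br 0 4 (Br 4 5 (Br 3 5 (Br 1 2 (Br 0 3 (Br 1 5 Full (Pk [:: 4; 5;
   1; 0; 3])) (Pk [:: 0; 4; 3; 1; 2])) (Pk [:: 2; 4; 1; 3; 5])) (Pk [:: 4; 5;
   3; 0; 1])) (Br 2 5 (Br 1 3 (Pk [:: 1; 3; 4; 2; 5]) (Br 1 2 (Deg 2 [:: 1; 3;
   4; 5]) (Pk [:: 2; 3; 1; 0; 4]))) (Pk [:: 2; 4; 5; 0; 1]))) (Pk [:: 0; 1; 4;
   2; 3])) (Pk [:: 2; 3; 4; 0; 1]))
  a' _ uvs vsY degY.
- by move=> q; rewrite !inE => /orP[]/eqP->.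
- by move=> q; rewrite !inE => /orP[]/eqP-> /=; rewrite e_sym.
- by [].
- by left.
(* Six vertices of full degree see nothing outside, so a seventh vertex [z] makes a seagull with
   [a'], [b'] and leaves the edge from [c'] to [d']. *)
have [z /setDP[zY zvs]|Yvs] := pickP (mem (Y :\: [set z in [:: a'; b'; c'; d'; w; w']])).
  have nz y : y \in [:: a'; b'; c'; d'; w; w'] -> ~~ e z y.
    move=> yvs; apply/negP; rewrite e_sym => yz.
    have uz : uniq [:: z; a'; b'; c'; d'; w; w'].
      by rewrite cons_uniq uvs andbT; rewrite inE in zvs.
    have zvsY : {subset [:: z; a'; b'; c'; d'; w; w'] <= Y}.
      by move=> t; rewrite inE => /orP[/eqP->|/vsY].
    have := leq_trans (count_le_deg y uz zvsY) (degY y (vsY y yvs)).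
    by rewrite -cat1s count_cat /= yz leqNgt ltnS => /negP[]; apply: (reg y yvs).
  left; exists [:: a'; b'; z; c'; d'].
  split.
  + have p5 : perm_eq (mask (nseq 5 true) [:: z; a'; b'; c'; d'; w; w'])
                      [:: a'; b'; z; c'; d'] by perm_tac.
    by rewrite -(perm_uniq p5) mask_uniq // cons_uniq uvs andbT; rewrite inE in zvs.
  + by move=> t; rewrite !inE => /or4P[/eqP->|/eqP->|/eqP->|/orP[]/eqP->] //;
       apply: vsY; rewrite !inE eqxx ?orbT.
  + by rewrite /= ab' cd' !nz // !inE eqxx ?orbT.
have eqY : Y =i [:: a'; b'; c'; d'; w; w'].
  move=> y; apply/idP/idP; last exact: vsY.
  by move=> yY; have := Yvs y; rewrite /= !inE yY andbT => /negbFE.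
right; split; first by rewrite (eq_card eqY); apply/card_uniqP.
by move=> y yY; apply: leq_trans (count_le_deg y uvs vsY); apply: reg; rewrite -eqY.
Qed.

Section EightVertices.
Hypothesis degY : {in Y, forall y, #|[set z in Y | e y z]| <= 3}.

(** Here [w] meets all three matching edges, so once these are oriented its adjacency to positions 0
    to 5 is known. *)
Let pack_triple a b c d f g w w' :
  uniq [:: a; b; c; d; f; g; w; w'] -> {subset [:: a; b; c; d; f; g; w; w'] <= Y} ->
  e a b -> e c d -> e f g -> e w a || e w b -> e w c || e w d -> e w f || e w g ->
  has_pack 2.
Proof.
move=> + + ab cd fg.
have [a' [b' [ab' wb pab <-]]] := orient w ab.
have [c' [d' [cd' wd pcd <-]]] := orient w cd.
have [f' [g' [fg' wg pfg <-]]] := orient w fg.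
have p : perm_eq [:: a; b; c; d; f; g; w; w'] [:: a'; b'; c'; d'; f'; g'; w; w'].
  by rewrite -[[:: a, b & _]]/([:: a; b] ++ [:: c; d] ++ [:: f; g] ++ [:: w; w'])
             -[[:: a', _ & _]]/([:: a'; b'] ++ [:: c'; d'] ++ [:: f'; g'] ++ [:: w; w'])
             !perm_cat.
rewrite (perm_uniq p) => uvs vsY' wa wc wf.
have vsY : {subset [:: a'; b'; c'; d'; f'; g'; w; w'] <= Y}.
  by move=> z; rewrite -(perm_mem p); apply: vsY'.
have [|||hp|[]//] := @pack_check 3 2 false
  [:: (0, 1); (2, 3); (4, 5); (6, 0); (6, 2); (6, 4)] [:: (6, 1); (6, 3); (6, 5)]
  (Br 3 7 (Br 6 7 (Deg 6 [:: 0; 2; 4; 7]) (Br 1 2 (Br 2 5 (Deg 2 [:: 1; 3; 5;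
   6]) (Br 2 4 (Tri 2 4 6) (Pk [:: 3; 7; 6; 4; 5; 2; 0; 1]))) (Br 0 2 (Tri 0 2
   6) (Pk [:: 0; 1; 2; 3; 7; 6; 4; 5])))) (Br 1 4 (Br 5 7 (Br 3 4 (Deg 4 [::
   1; 3; 5; 6]) (Br 6 7 (Deg 6 [:: 0; 2; 4; 7]) (Br 2 4 (Tri 2 4 6) (Pk [:: 2;
   3; 4; 5; 7; 6; 0; 1])))) (Br 2 7 (Br 2 5 (Deg 2 [:: 3; 5; 6; 7]) (Br 3 4
   (Deg 4 [:: 1; 3; 5; 6]) (Pk [:: 2; 7; 5; 4; 6; 3; 0; 1]))) (Br 0 5 (Br 2 5
   (Br 0 3 (Deg 0 [:: 1; 3; 5; 6]) (Pk [:: 0; 6; 3; 2; 5; 7; 1; 4])) (Br 1 3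
   (Br 1 7 (Deg 1 [:: 0; 3; 4; 7]) (Br 0 2 (Tri 0 2 6) (Pk [:: 0; 5; 2; 1; 3;
   7; 4; 6]))) (Br 6 7 (Deg 6 [:: 0; 2; 4; 7]) (Br 3 4 (Deg 4 [:: 1; 3; 5; 6])
   (Pk [:: 1; 4; 3; 2; 6; 7; 0; 5]))))) (Pk [:: 0; 6; 5; 2; 3; 7; 1; 4]))))
   (Br 0 4 (Tri 0 4 6) (Br 6 7 (Deg 6 [:: 0; 2; 4; 7]) (Br 5 7 (Pk [:: 0; 1;
   4; 5; 7; 6; 2; 3]) (Br 3 5 (Pk [:: 0; 1; 4; 3; 5; 7; 2; 6]) (Br 0 7 (Br 0 5
   (Deg 0 [:: 1; 5; 6; 7]) (Pk [:: 0; 7; 5; 4; 6; 1; 2; 3])) (Br 1 5 (Br 4 7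
   (Pk [:: 1; 5; 6; 4; 7; 0; 2; 3]) (Br 2 5 (Br 0 3 (Pk [:: 0; 3; 7; 4; 6; 1;
   2; 5]) (Br 0 2 (Tri 0 2 6) (Pk [:: 2; 3; 0; 4; 6; 7; 1; 5]))) (Pk [:: 2; 3;
   5; 4; 6; 7; 0; 1]))) (Pk [:: 0; 6; 7; 4; 5; 1; 2; 3])))))))))
  a' _ uvs vsY degY.
- by move=> q; rewrite !inE => /or4P[|||/or3P[]]/eqP->.
- by move=> q; rewrite !inE => /or3P[]/eqP->.
- by [].
- by [].
Qed.

Let pack_double a b c d f g w w' :
  uniq [:: a; b; c; d; f; g; w; w'] -> {subset [:: a; b; c; d; f; g; w; w'] <= Y} ->
  e a b -> e c d -> e f g -> e w a || e w b -> e w c || e w d ->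
  ~~ (e w f || e w g) -> has_pack 2.
Proof.
move=> + + ab cd fg.
have [a' [b' [ab' wb pab <-]]] := orient w ab.
have [c' [d' [cd' wd pcd <-]]] := orient w cd.
have p : perm_eq [:: a; b; c; d; f; g; w; w'] [:: a'; b'; c'; d'; f; g; w; w'].
  by rewrite -[[:: a, b & _]]/([:: a; b] ++ [:: c; d] ++ [:: f; g; w; w'])
             -[[:: a', _ & _]]/([:: a'; b'] ++ [:: c'; d'] ++ [:: f; g; w; w'])
             !perm_cat.
rewrite (perm_uniq p) negb_or => uvs vsY' wa wc /andP[wf wg].
have vsY : {subset [:: a'; b'; c'; d'; f; g; w; w'] <= Y}.
  by move=> z; rewrite -(perm_mem p); apply: vsY'.
have [|||hp|[]//] := @pack_check 3 2 false
  [:: (0, 1); (2, 3); (4, 5); (6, 0); (6, 2)] [:: (6, 1); (6, 3); (6, 4); (6, 5)]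
  (Br 2 7 (Br 0 3 (Br 1 2 (Deg 2 [:: 1; 3; 6; 7]) (Br 0 7 (Deg 0 [:: 1; 3; 6;
   7]) (Br 3 7 (Tri 2 3 7) (Pk [:: 0; 3; 7; 2; 6; 1; 4; 5])))) (Br 1 7 (Br 0 2
   (Tri 0 2 6) (Pk [:: 2; 3; 0; 4; 5; 6; 1; 7])) (Br 1 2 (Deg 2 [:: 1; 3; 6;
   7]) (Pk [:: 0; 6; 3; 2; 7; 1; 4; 5])))) (Br 3 7 (Br 0 2 (Tri 0 2 6) (Br 1 2
   (Br 1 7 (Br 0 3 (Br 0 4 (Deg 0 [:: 1; 3; 4; 6]) (Br 2 5 (Deg 2 [:: 1; 3; 5;
   6]) (Br 3 4 (Deg 3 [:: 0; 2; 4; 7]) (Pk [:: 0; 3; 4; 2; 6; 5; 1; 7])))) (Pk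
   [:: 2; 3; 0; 4; 5; 6; 1; 7])) (Br 0 3 (Pk [:: 1; 2; 7; 4; 5; 6; 0; 3]) (Pk
   [:: 0; 6; 3; 1; 2; 7; 4; 5]))) (Pk [:: 0; 1; 2; 4; 5; 6; 3; 7]))) (Pk [::
   2; 3; 7; 4; 5; 6; 0; 1])))
  a' _ uvs vsY degY.
- by move=> q; rewrite !inE => /or4P[|||/orP[]]/eqP->.
- by move=> q; rewrite !inE => /or4P[]/eqP->.
- by [].
- by [].
Qed.

(** If [w] meets at least two of the three matching edges, a certificate applies. If it misses two,
    then either [w'] misses one and the packing is explicit, or [w'] meets all three and takes the
    role of [w]. *)
Lemma has_pack2 : 8 <= #|Y| -> matchable e 3 Y -> has_pack 2.
Proof.
move=> cY M.
have [l [ws [sl sws]]] := matching_list M (cY : 3.*2 + 2 <= _).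
case: l sl => [|[a b] [|[c d] [|[f g] []]]] // _; case: ws sws => [|w [|w' []]] // _ U S /and4P[/= ab cd fg _].
have reorder vs' : perm_eq [:: a; b; c; d; f; g; w; w'] vs' -> uniq vs' /\ {subset vs' <= Y}.
  by move=> p; rewrite -(perm_uniq p); split=> // z; rewrite -(perm_mem p); apply: S.
have direct a1 b1 a2 b2 a3 b3 w1 w2 :
    perm_eq [:: a; b; c; d; f; g; w; w'] [:: a1; b1; w1; a2; b2; w2; a3; b3] ->
    e a1 b1 -> e a2 b2 -> e a3 b3 -> ~~ (e w1 a1 || e w1 b1) ->
    ~~ (e w2 a2 || e w2 b2) -> has_pack 2.
  move=> /reorder[U' S'] e1 e2 e3; rewrite !negb_or => /andP[n1 m1] /andP[n2 m2].
  by exists [:: a1; b1; w1; a2; b2; w2; a3; b3]; split=> //=; rewrite e1 e2 e3 n1 m1 n2 m2.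
have miss2 a1 b1 a2 b2 a3 b3 :
    perm_eq [:: a; b; c; d; f; g; w; w'] [:: a1; b1; a2; b2; a3; b3; w; w'] ->
    e a1 b1 -> e a2 b2 -> e a3 b3 -> ~~ (e w a1 || e w b1) ->
    ~~ (e w a2 || e w b2) -> has_pack 2.
  move=> p e1 e2 e3 n1 n2.
  have [h1|m1] := boolP (e w' a1 || e w' b1); last first.
    apply: (direct a2 b2 a1 b1 a3 b3 w w') => //.
    by apply: perm_trans p _; perm_tac.
  have [h2|m2] := boolP (e w' a2 || e w' b2); last first.
    apply: (direct a1 b1 a2 b2 a3 b3 w w') => //.
    by apply: perm_trans p _; perm_tac.
  have [h3|m3] := boolP (e w' a3 || e w' b3); last first.
    apply: (direct a1 b1 a3 b3 a2 b2 w w') => //.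
    by apply: perm_trans p _; perm_tac.
  have [|U' S'] := reorder [:: a1; b1; a2; b2; a3; b3; w'; w].
    by apply: perm_trans p _; perm_tac.
  exact: (pack_triple U' S').
have [h1|n1] := boolP (e w a || e w b); have [h2|n2] := boolP (e w c || e w d);
  have [h3|n3] := boolP (e w f || e w g).
- exact: (pack_triple U S).
- exact: (pack_double U S).
- have [|U' S'] := reorder [:: a; b; f; g; c; d; w; w'].
    by perm_tac.
  exact: (pack_double U' S').
- by apply: (miss2 c d f g a b) => //; perm_tac.
- have [|U' S'] := reorder [:: c; d; f; g; a; b; w; w'].
    by perm_tac.
  exact: (pack_double U' S').
- by apply: (miss2 a b f g c d) => //; perm_tac.
- by apply: (miss2 a b c d f g).
- by apply: (miss2 a b c d f g).
Qed.

End EightVertices.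
End SeagullPacking.

Lemma double_count (T : finType) (r : rel T) (S K : {set T}) : symmetric r ->
  \sum_(v in S) #|[set a in K | r v a]| = \sum_(a in K) #|[set v in S | r a v]|.
Proof.
move=> r_sym.
have cardE (B : {set T}) v : #|[set a in B | r v a]| = \sum_(a in B) r v a.
  rewrite -sum1_card big_mkcond [RHS]big_mkcond; apply: eq_bigr => a _.
  by rewrite inE; case: (a \in B); case: (r v a).
under eq_bigr do rewrite cardE.
rewrite exchange_big; apply: eq_bigr => a _; rewrite cardE.
by apply: eq_bigr => v _; rewrite r_sym.
Qed.

Lemma list_matchable (T : finType) (r : rel T) (A : {set T}) (l : seq (T * T)) :
  uniq (flatten [seq [:: p.1; p.2] | p <- l]) ->
  {subset flatten [seq [:: p.1; p.2] | p <- l] <= A} ->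
  all (fun p => r p.1 p.2) l -> matchable r (size l) A.
Proof.
elim: l A => [|[x y] l IHl] A //= /and3P[+ yl ul] lA /andP[xy rl].
rewrite inE negb_or => /andP[nxy xl].
apply: (matchable_add xy) => //; [by apply: lA; rewrite !inE eqxx ?orbT..|].
apply: IHl => // z zl; rewrite !inE lA ?inE ?zl ?orbT // andbT.
by apply/andP; split; [apply: contraNneq yl|apply: contraNneq xl] => <-.
Qed.

(** * Coadjacency and the branch sets it provides *)

Definition coadj (G : sgraph) : rel G := fun x y => (x != y) && ~~ (x -- y).

Section Coadjacency.
Variable G : sgraph.
Implicit Types (x y z u v w : G) (A B Z : {set G}).

Lemma coadj_sym : symmetric (@coadj G).
Proof. by move=> x y; rewrite /coadj eq_sym sedge_sym. Qed.

Lemma coadj_irr : irreflexive (@coadj G).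
Proof. by move=> x; rewrite /coadj eqxx. Qed.

Lemma adj_of_coadjN x y : x != y -> ~~ coadj x y -> x -- y.
Proof. by rewrite /coadj => ->; rewrite negbK. Qed.

Lemma independent_model A : {in A &, forall x y, ~~ coadj x y} -> clique_model A #|A|.
Proof.
by move=> indA; apply: clique_model_clique => x y xA yA xy; apply: adj_of_coadjN (indA _ _ _ _).
Qed.

Hypothesis tri : forall x y z, coadj x y -> coadj y z -> ~~ coadj x z.

(* A vertex outside the seagull uwv misses in G at most one of the coadjacent u, v. *)
Lemma seagull_model A u v w t :
  coadj u v -> ~~ coadj w u -> ~~ coadj w v -> w != u -> w != v ->
  [disjoint A & [set u; v; w]] -> clique_model A t ->
  clique_model (A :|: [set u; v; w]) t.+1.
Proof.
move=> uv wu wv nwu nwv dA; apply: clique_model_add => //.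
- by apply/set0Pn; exists u; rewrite !inE eqxx.
- by apply: set_connected3; apply: adj_of_coadjN.
move=> a aA; have := disjointFr dA aA; rewrite !inE => /negbT.
rewrite !negb_or -andbA => /and3P[au av _].
have [cau|nau] := boolP (coadj a u).
  exists v; first by rewrite !inE eqxx orbT.
  exact: adj_of_coadjN av (tri cau uv).
by exists u; [rewrite !inE eqxx|apply: adj_of_coadjN].
Qed.

(** The edge that closes the list forms a seagull with [x], which is coadjacent to nothing in the
    list; every triple is a seagull by itself. *)
Lemma pack_model A x q s t :
  x \notin A -> uniq q -> {in q, forall y, [/\ y \notin A, y != x & ~~ coadj x y]} ->
  pack (@coadj G) (fun x y => ~~ coadj x y) s q -> clique_model A t ->
  clique_model (A :|: [set z in x :: q]) (t + s.+1).
Proof.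
move=> xA; elim: s q => [|s IHs] [|i [|j [|k q]]] //.
  rewrite [uniq _]/= inE andbT => ij qP cij MA.
  have [iA ix xi] := qP i (mem_head _ _).
  have [jA jx xj] : [/\ j \notin A, j != x & ~~ coadj x j].
    by apply: qP; rewrite !inE eqxx orbT.
  rewrite addn1; apply: (clique_modelW _ (leqnn _) (@seagull_model A i j x t cij xi xj _ _ _ MA)).
  - by apply/subsetP => z; rewrite !inE => /orP[->//|/orP[/orP[]|]->]; rewrite ?orbT.
  - by rewrite eq_sym.
  - by rewrite eq_sym.
  - rewrite disjoint_sym disjoint_subset; apply/subsetP => z.
    by rewrite !inE => /orP[/orP[]|] /eqP->.
rewrite cons_uniq [uniq (j :: _)]/= => /and4P[ijkq jkq kq uq] qP.
case/and4P=> cij ki kj Pq MA.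
have qP' : {in q, forall y, [/\ y \notin A, y != x & ~~ coadj x y]}.
  by move=> y yq; apply: qP; rewrite !inE yq !orbT.
have {}IHs := IHs q uq qP' Pq MA.
have mem_ijk y : y \in [:: i; j; k] -> [/\ y \notin A, y != x & y \notin q].
  move=> yijk; have [|yA yx _] := qP y.
    by move: yijk; rewrite !inE => /or3P[]->; rewrite ?orbT.
  split=> //; move: yijk ijkq jkq kq; rewrite !inE !negb_or.
  by case/or3P=> /eqP-> => [/and3P[]|_ /andP[]|].
rewrite addnS.
apply: (clique_modelW _ (leqnn _) (@seagull_model _ i j k _ cij ki kj _ _ _ IHs)).
- apply/subsetP => z; rewrite !inE -!orbA.
  by case/or4P=> [->|->|->|/or3P[]->]; rewrite ?orbT.
- by move: ijkq; rewrite !inE !negb_or (eq_sym k) => /and3P[].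
- by move: jkq; rewrite !inE !negb_or (eq_sym k) => /andP[].
- rewrite disjoint_sym disjoint_subset; apply/subsetP => z zijk; rewrite !inE.
  have [|zA zx zq] := mem_ijk z; first by move: zijk; rewrite !inE -orbA.
  by rewrite (negPf zA) (negPf zx) (negPf zq).
Qed.

(** The relation [r] is arbitrary because only selected edges of [G] will qualify as branch sets
    that touch pairwise. *)
Lemma matching_model (r : rel G) k B :
  {in B &, forall u v, r u v -> u -- v} ->
  (forall u v u' v', u \in B -> v \in B -> u' \in B -> v' \in B ->
    r u v -> r u' v' -> touch [set u; v] [set u'; v']) ->
  matchable r k B ->
  exists Bs, [/\ size Bs = k,
    forall P, P \in Bs -> exists u v, [/\ u \in B, v \in B, r u v & P = [set u; v]]
    & pairwise (fun P P' : {set G} => [disjoint P & P'] && touch P P') Bs].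
Proof.
move=> rB rT.
have: B \subset B by []; move: {1 3 4 5}B => B'.
elim: k B' => [|k IHk] B' B'B; first by exists [::].
case/matchableSP=> u [v [uB' vB' uv M]].
have [|Bs [sBs BsP pBs]] := IHk _ _ M.
  by apply: subset_trans B'B; subset_tac.
move: vB'; rewrite !inE => /andP[vu vB'].
exists ([set u; v] :: Bs); rewrite /= sBs pBs andbT; split=> //.
- move=> P; rewrite inE => /orP[/eqP->|/BsP[a [b [aB bB ab ->]]]]; first by exists u, v.
  by exists a, b; move: aB bB; rewrite !inE => /and3P[_ _ ->] /and3P[_ _ ->].
- apply/allP => P /BsP[a [b [aB bB ab ->]]].
  move: aB bB; rewrite !inE => /and3P[av au aB] /and3P[bv bu bB].
  rewrite rT ?andbT ?(subsetP B'B) //.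
  rewrite disjoint_subset; apply/subsetP => z.
  rewrite !inE => /orP[]/eqP->; rewrite negb_or.
    by rewrite ![u == _]eq_sym au bu.
  by rewrite ![v == _]eq_sym av bv.
Qed.

End Coadjacency.

Section Neighbourhoods.
Variable G : sgraph.
Implicit Types (x y : G) (A : {set G}).

Definition nbr A x := [set z in A | coadj x z].
Definition far A x := [set y in A | (y != x) && ~~ coadj x y].

Lemma card_nbr_far A x : x \in A -> #|A| = (#|nbr A x| + #|far A x|).+1.
Proof.
move=> xA; rewrite (cardsD1 x) xA add1n -(cardsID (nbr A x) (A :\ x)).
congr (_ + _).+1; apply: eq_card => y; rewrite !inE.
  by have [->|] := eqVneq y x; case: (y \in A); rewrite ?coadj_irr ?andbT ?andbF.
by have [->|] := eqVneq y x; case: (y \in A); rewrite ?coadj_irr ?andbT ?andbF.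
Qed.

End Neighbourhoods.

(** * Odd sets of codiameter two, around a vertex of maximum codegree *)

Section Core.
Variable G : sgraph.
Implicit Types (y z u v w a b : G).
Hypothesis tri : forall x y z : G, coadj x y -> coadj y z -> ~~ coadj x z.
Hypothesis diff : forall u v w : G, coadj v w -> coadj w u ->
  #|[set a | coadj v a && ~~ coadj u a]| <= 3.
Variables (A : {set G}) (x : G).
Hypothesis diam : forall y z, y \in A -> z \in A -> y != z -> ~~ coadj y z ->
  exists w, [/\ w \in A, coadj y w & coadj w z].
Hypothesis xA : x \in A.
Notation C := (nbr A x).
Notation Y := (far A x).
Notation D := #|C|.
Hypothesis maxD : {in A, forall y, #|nbr A y| <= D}.

Lemma mem_far y : y \in Y -> [/\ y \in A, y != x & ~~ coadj x y].
Proof. by rewrite inE => /and3P[]. Qed.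

Lemma mem_nbr a : a \in C -> [/\ a \in A, a != x & coadj x a].
Proof.
rewrite inE => /andP[aA xa]; split=> //.
by apply: contraTneq xa => ->; rewrite coadj_irr.
Qed.

Lemma nbr_meets_far u y :
  u \in A -> y \in far A u -> 0 < #|[set a in nbr A u | coadj y a]|.
Proof.
move=> uA; rewrite inE => /and3P[yA yu uy].
have [|w [wA uw wy]] := diam uA yA _ uy; first by rewrite eq_sym.
by apply/card_gt0P; exists w; rewrite !inE wA uw coadj_sym.
Qed.

(** A far vertex has a common coneighbour with [x], so [diff] bounds by 3 the part of C that it
    misses. *)
Lemma nbr_covers_far y : y \in Y -> D <= #|[set a in C | coadj y a]| + 3.
Proof.
case/mem_far=> yA yx xy; have [|w [wA xw wy]] := diam xA yA _ xy; first by rewrite eq_sym.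
rewrite -(cardsID [set a | coadj y a] C); apply: leq_add.
  by rewrite subset_leq_card //; apply/subsetP => a; rewrite !inE.
apply: leq_trans (diff xw wy); rewrite subset_leq_card //.
by apply/subsetP => a; rewrite !inE => /and3P[-> _ ->].
Qed.

Lemma deg_far y : y \in Y ->
  #|[set z in Y | coadj y z]| + #|[set a in C | coadj y a]| <= D.
Proof.
move=> yY; have [yA _ _] := mem_far yY; apply: leq_trans (maxD yA).
rewrite -cardsUI (_ : _ :&: _ = set0) ?cards0 ?addn0; last first.
  by apply/setP => z; rewrite !inE; case: (coadj x z); rewrite ?andbF.
rewrite subset_leq_card //; apply/subsetP => z.
by rewrite !inE => /orP[] /andP[/andP[-> _] ->].
Qed.

Lemma max_deg_le6 y z : y \in Y -> z \in Y -> coadj y z -> D <= 6.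
Proof.
move=> yY zY yz; have hy := nbr_covers_far yY; have hz := nbr_covers_far zY.
have: #|[set a in C | coadj y a]| + #|[set a in C | coadj z a]| <= D.
  rewrite -cardsUI (_ : _ :&: _ = set0) ?cards0 ?addn0; last first.
    apply/setP => a; rewrite !inE; apply/negP => /andP[/andP[_ ya] /andP[_ za]].
    by rewrite coadj_sym in yz; have := tri yz ya; rewrite za.
  by rewrite subset_leq_card //; apply/subsetP => a; rewrite !inE => /orP[]/andP[].
by move: hy hz; clear; lia.
Qed.

Lemma deg_nbr u a :
  u \in A -> a \in nbr A u -> #|[set y in far A u | coadj a y]| < D.
Proof.
move=> uA; rewrite inE => /andP[aA ua]; apply: leq_trans (maxD aA).
rewrite (cardsD1 u (nbr A a)) inE uA coadj_sym ua add1n ltnS.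
rewrite subset_leq_card //; apply/subsetP => y.
by rewrite !inE => /andP[/and3P[-> -> _] ->].
Qed.

(** Each vertex of [nbr A u] spends one coneighbour on [u] and has at most D - 1 left. The vertex
    [u] is arbitrary because the bound is also applied at vertices of Y. *)
Lemma edges_nbr_far u : u \in A ->
  \sum_(y in far A u) #|[set a in nbr A u | coadj y a]| <= #|nbr A u| * D.-1.
Proof.
move=> uA; rewrite (double_count _ _ (@coadj_sym G)) -sum_nat_const.
by apply: leq_sum => a au; have := deg_nbr uA au; case: D.
Qed.

Lemma card_far_le : #|Y| <= D * D.-1.
Proof.
apply: leq_trans (edges_nbr_far xA); rewrite -sum1_card; apply: leq_sum => y.
exact: nbr_meets_far.
Qed.

Lemma card_far_le3 : #|Y| * (D - 3) <= D * D.-1.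
Proof.
apply: leq_trans (edges_nbr_far xA); rewrite -sum_nat_const; apply: leq_sum => y yY.
by rewrite leq_subLR addnC nbr_covers_far.
Qed.

(** Rules out the regular exceptions of the packing lemmas. If all codegrees inside Y were at least
    D - 1, each far vertex would have exactly one coneighbour in C, and by |Y| < 2D some [a] in C
    would have at most one coneighbour [w] in Y. Codiameter two then makes [w] coadjacent to the
    rest of Y, giving it codegree above D. *)
Lemma low_degree_far : D < #|Y| -> #|Y| < D.*2 ->
  exists2 y, y \in Y & #|[set z in Y | coadj y z]| < D.-1.
Proof.
move=> ltDY ltY2.
have [y /andP[yY dy]|high] := pickP (fun y => (y \in Y) && (#|[set z in Y | coadj y z]| < D.-1)).
  by exists y.
have dY y : y \in Y -> D.-1 <= #|[set z in Y | coadj y z]|.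
  by move=> yY; have := high y; rewrite yY /= => /negbT; rewrite -leqNgt.
have c1 y : y \in Y -> #|[set a in C | coadj y a]| = 1.
  move=> yY; have := deg_far yY; have := dY y yY; have := nbr_meets_far xA yY.
  by move: #|_| #|_| #|_|; clear; lia.
have sumC : \sum_(a in C) #|[set y in Y | coadj a y]| = #|Y|.
  rewrite -(double_count _ _ (@coadj_sym G)) -sum1_card.
  by apply: eq_bigr => y /c1.
have [a /andP[aC ta]|big] := pickP (fun a => (a \in C) && (#|[set y in Y | coadj a y]| <= 1)).
  have [aA ax xa] := mem_nbr aC.
  (* A common coneighbour of [a] and [y] lies in Y: C spans no coedge, and [x] is not coadjacent to
     [y]. *)
  have dom y : y \in Y -> ~~ coadj a y ->
      exists2 w, w \in [set y in Y | coadj a y] & coadj w y.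
    move=> yY ay; have [yA yx xy] := mem_far yY.
    have nay : a != y by apply: contraTneq xa => ->.
    have [w [wA aw wy]] := diam aA yA nay ay; exists w => //.
    rewrite !inE wA aw (tri xa aw) !andbT.
    by apply: contraTneq wy => ->.
  have /card_gt0P[y0 y0Y] : 0 < #|Y| by apply: leq_ltn_trans ltDY.
  have [w wt] : exists w, w \in [set y in Y | coadj a y].
    have [ay0|/(dom _ y0Y)[w ? _]] := boolP (coadj a y0); last by exists w.
    by exists y0; rewrite !inE in y0Y *; rewrite y0Y.
  have wY : w \in Y by move: wt; rewrite inE => /andP[].
  have tw y : y \in [set y in Y | coadj a y] -> y = w.
    by move=> yt; apply: (card_le1_eqP ta).
  have sub : Y :\ w \subset [set z in Y | coadj w z].
    apply/subsetP => y /setD1P[yw yY]; rewrite inE yY /=.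
    have [ay|/(dom _ yY)[w' /tw-> //]] := boolP (coadj a y).
    by case/eqP: yw; apply: tw; rewrite inE yY.
  have := subset_leq_card sub; have := deg_far wY; have := nbr_meets_far xA wY.
  move: ltDY; rewrite (cardsD1 w Y) wY add1n.
  by move: #|_| #|_| #|_| #|_|; clear; lia.
have: \sum_(a in C) 2 <= \sum_(a in C) #|[set y in Y | coadj a y]|.
  by apply: leq_sum => a aC; have := big a; rewrite aC /= => /negbT; rewrite -ltnNge.
by rewrite sum_nat_const sumC muln2 leqNgt ltY2.
Qed.

Lemma nbr_independent : {in C &, forall a b, ~~ coadj a b}.
Proof.
move=> a b /mem_nbr[_ _ xa] /mem_nbr[_ _ xb]; apply: tri xb.
by rewrite coadj_sym.
Qed.

Lemma nbr_model : clique_model C D.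
Proof. exact: independent_model nbr_independent. Qed.

Lemma pack_far_model s : has_pack (@coadj G) Y s -> clique_model A (D + s.+1).
Proof.
case=> q [uq qY Pq].
have xC : x \notin C by rewrite inE coadj_irr andbF.
apply: clique_modelW (leqnn _) (pack_model tri xC uq _ Pq nbr_model) => [|y /qY yY].
  apply/subsetP => z; rewrite !inE => /or3P[/andP[]//|/eqP->//|/qY].
  by case/mem_far.
have [yA yx xy] := mem_far yY; split=> //.
by rewrite inE (negPf xy) andbF.
Qed.

Lemma far_independent_model (T : {set G}) t :
  T \subset Y -> {in T &, forall y z, ~~ coadj y z} -> t <= #|T|.+1 ->
  clique_model (x |: T) t.
Proof.
move=> TY indT tT.
have xT : x \notin T by apply/negP => /(subsetP TY); rewrite inE eqxx andbF.
apply: clique_modelW (subxx _) _ (independent_model (A := x |: T) _).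
  by rewrite cardsU1 xT.
move=> y z /setU1P[->|yT] /setU1P[->|zT]; first by rewrite coadj_irr.
- by case/(subsetP TY)/mem_far: zT.
- by rewrite coadj_sym; case/(subsetP TY)/mem_far: yT.
- exact: indT.
Qed.


Let indep (T : {set G}) := {in T &, forall y z, ~~ coadj y z}.

Let indepU1 p (T : {set G}) :
  indep T -> (forall z, z \in T -> ~~ coadj p z) -> indep (p |: T).
Proof.
move=> iT pT y z /setU1P[->|yT] /setU1P[->|zT]; first by rewrite coadj_irr.
- exact: pT.
- by rewrite coadj_sym pT.
- exact: iT.
Qed.

(** The vertices of Y off a coedge [ab] span no coedge. Not both [a] and [b] have coneighbours among
    them: these would be distinct and give two disjoint coedges. So one of [a], [b] joins them, and
    so does [x]. *)
Lemma far_matching1_model :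
  matchable (@coadj G) 1 Y -> ~~ matchable (@coadj G) 2 Y -> clique_model A #|Y|.
Proof.
case/matchableSP=> a [b [aY bY ab _]] n2; move: bY; rewrite in_setD1 => /andP[ba bY].
set W := Y :\ a :\ b.
have no2 p q r s : uniq [:: p; q; r; s] -> {subset [:: p; q; r; s] <= Y} ->
    coadj p q -> coadj r s -> False.
  move=> U S pq rs; case/negP: n2.
  by apply: (@list_matchable _ _ _ [:: (p, q); (r, s)]) => //=; rewrite pq rs.
have memW w : w \in W -> [/\ w \in Y, w != a & w != b].
  by case/setD1P=> wb /setD1P[].
have iW : indep W.
  move=> w w' wW w'W; have [wY wa wb] := memW w wW; have [wY' wa' wb'] := memW w' w'W.
  apply/negP => ww'; apply: (no2 a b w w') => //.
    have nww' : w != w' by apply: contraTneq ww' => ->; rewrite coadj_irr.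
    by rewrite /= !inE !negb_or nww' ![a == _]eq_sym ba wa wa' ![b == _]eq_sym wb wb'.
  by apply/(@allP _ (mem Y)); rewrite /= aY bY wY wY'.
have sub p : p \in Y -> p |: W \subset Y.
  by move=> pY; rewrite subUset sub1set pY; apply/subsetP => z /memW[].
have fin p : p \in [set a; b] -> (forall w, w \in W -> ~~ coadj p w) -> clique_model A #|Y|.
  move=> pab pW.
  have pY : p \in Y by case/set2P: pab => ->.
  have pnW : p \notin W by case/set2P: pab => ->; rewrite !inE eqxx ?andbF.
  apply: clique_modelW (leqnn _) (far_independent_model (sub p pY) (indepU1 iW pW) _).
    rewrite subUset sub1set xA; apply/subsetP => z /(subsetP (sub p pY)).
    by case/mem_far.
  rewrite cardsU1 pnW (cardsD1 a Y) aY (cardsD1 b (Y :\ a)) in_setD1 ba bY.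
  by rewrite -/W; move: #|_|; clear; lia.
have [w /andP[wW aw]|na] := pickP (fun w => (w \in W) && coadj a w); last first.
  apply: (fin a); first by rewrite !inE eqxx.
  by move=> w wW; have := na w; rewrite wW => /= ->.
apply: (fin b); first by rewrite !inE eqxx orbT.
move=> w' w'W; apply/negP => bw'.
have [wY wa wb] := memW w wW; have [wY' wa' wb'] := memW w' w'W.
apply: (no2 a w b w') => //.
  have nww' : w != w' by apply: contraTneq aw => ->; apply: tri bw'.
  by rewrite /= !inE !negb_or nww' ![a == _]eq_sym ba wa wa' ![b == _]eq_sym wb wb'.
by apply/(@allP _ (mem Y)); rewrite /= aY bY wY wY'.
Qed.

(** Let W be the rest of Y. If two of the four ends can be added to W, a clique with [x] results.
    Otherwise [b1], [b2] are coadjacent, and [a1], [a2] have the same single coneighbour [w1] in W,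
    as there are no three disjoint coedges. Then [x], [a1], [a2] and W minus [w1] form a clique, and
    [b1], [b2], [w1] a seagull. *)
Let far_matching2_oriented a1 b1 a2 b2 :
  ~~ matchable (@coadj G) 3 Y ->
  uniq [:: a1; b1; a2; b2] -> {subset [:: a1; b1; a2; b2] <= Y} ->
  coadj a1 b1 -> coadj a2 b2 ->
  (forall w, w \in Y -> w \notin [:: a1; b1; a2; b2] -> ~~ coadj b1 w) ->
  (forall w, w \in Y -> w \notin [:: a1; b1; a2; b2] -> ~~ coadj b2 w) ->
  clique_model A #|Y|.-1.
Proof.
move=> n3 U S ab1 ab2 nb1 nb2.
set W := [set w in Y | w \notin [:: a1; b1; a2; b2]].
have memW w : w \in W -> w \in Y /\ w \notin [:: a1; b1; a2; b2].
  by rewrite [w \in W]inE => /andP[].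
have cW : #|Y| = #|W| + 4.
  rewrite -(cardsID [set z in [:: a1; b1; a2; b2]] Y) addnC; congr (_ + _).
    by apply: eq_card => z; rewrite [z \in W]inE in_setD inE andbC.
  rewrite (_ : _ :&: _ = [set z in [:: a1; b1; a2; b2]]).
    by rewrite cardsE; apply/card_uniqP.
  by apply/setIidPr/subsetP => z; rewrite inE; apply: S.
have no3 w w' p1 q1 p2 q2 p3 q3 : w \in W -> w' \in W -> w != w' ->
    perm_eq [:: a1; b1; a2; b2; w; w'] [:: p1; q1; p2; q2; p3; q3] ->
    coadj p1 q1 -> coadj p2 q2 -> coadj p3 q3 -> False.
  move=> /memW[wY wl] /memW[w'Y w'l] ww' p e1 e2 e3; case/negP: n3.
  apply: (@list_matchable _ _ _ [:: (p1, q1); (p2, q2); (p3, q3)]).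
  - rewrite -(perm_uniq p) -[[:: a1, _ & _]]/([:: a1; b1; a2; b2] ++ [:: w; w']).
    by rewrite cat_uniq U /= (negPf wl) (negPf w'l) inE ww'.
  - move=> z; rewrite -(perm_mem p) -[[:: a1, _ & _]]/([:: a1; b1; a2; b2] ++ [:: w; w']).
    by rewrite mem_cat => /orP[/S //|]; rewrite in_cons mem_seq1 => /orP[]/eqP->.
  - by rewrite /= e1 e2 e3.
have iW : indep W.
  move=> w w' wW w'W; apply/negP => ww'.
  have nww' : w != w' by apply: contraTneq ww' => ->; rewrite coadj_irr.
  by apply: (no3 w w' a1 b1 a2 b2 w w').
have nW p : p \in [:: a1; b1; a2; b2] -> p \notin W.
  by move=> pl; rewrite [p \in W]inE pl andbF.
have [pa1 pb1 pa2 pb2] : [/\ a1 \in [:: a1; b1; a2; b2], b1 \in [:: a1; b1; a2; b2],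
    a2 \in [:: a1; b1; a2; b2] & b2 \in [:: a1; b1; a2; b2]].
  by rewrite !inE !eqxx !orbT.
have [[d12 d13 d14 d23] [d24 d34]] :
    [/\ a1 != b1, a1 != a2, a1 != b2 & b1 != a2] /\ (b1 != b2 /\ a2 != b2).
  by move: U; rewrite /= !inE !negb_or -!andbA => /and5P[-> -> -> -> /and3P[-> ->]].
have subA (T : {set G}) : T \subset Y -> x |: T \subset A.
  move=> TY; rewrite subUset sub1set xA; apply/subsetP => z /(subsetP TY).
  by case/mem_far.
have subU p q : p \in [:: a1; b1; a2; b2] -> q \in [:: a1; b1; a2; b2] ->
    p |: (q |: W) \subset Y.
  move=> pl ql; rewrite !subUset !sub1set !S //.
  by apply/subsetP => z /memW[].
have two p q : p \in [:: a1; b1; a2; b2] -> q \in [:: a1; b1; a2; b2] -> p != q ->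
    ~~ coadj p q -> (forall w, w \in W -> ~~ coadj p w) ->
    (forall w, w \in W -> ~~ coadj q w) -> clique_model A #|Y|.-1.
  move=> pl ql pq npq pW qW.
  have iT : indep (p |: (q |: W)).
    by apply: indepU1 (indepU1 iW qW) _ => z /setU1P[->|/pW].
  apply: clique_modelW (subA _ (subU p q pl ql)) (leqnn _)
           (far_independent_model (subU p q pl ql) iT _).
  by rewrite !cardsU1 inE negb_or inE pq !nW //= cW; move: #|W|; clear; lia.
have b1W w : w \in W -> ~~ coadj b1 w by case/memW; apply: nb1.
have b2W w : w \in W -> ~~ coadj b2 w by case/memW; apply: nb2.
have [b12|n12] := boolP (coadj b1 b2); last exact: (two b1 b2).
have b21 : coadj b2 b1 by rewrite coadj_sym.
have [w1 /andP[w1W aw1]|na1] := pickP (fun w => (w \in W) && coadj a1 w); last first.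
  apply: (two a1 b2) => //; first exact: tri b12.
  by move=> w wW; have := na1 w; rewrite wW => /= ->.
have [w2 /andP[w2W aw2]|na2] := pickP (fun w => (w \in W) && coadj a2 w); last first.
  apply: (two a2 b1) => //; [by rewrite eq_sym|exact: tri b21|].
  by move=> w wW; have := na2 w; rewrite wW => /= ->.
have uniq_w u v : u \in W -> v \in W -> coadj a1 u -> coadj a2 v -> u = v.
  move=> uW vW au av; apply/eqP/negPn/negP => uv.
  by apply: (no3 u v a1 u b1 b2 a2 v) => //; perm_tac.
have w12 := uniq_w _ _ w1W w2W aw1 aw2; subst w2.
have iT : indep (a1 |: (a2 |: W :\ w1)).
  apply: indepU1; first apply: indepU1.
  - by move=> y z /setD1P[_ yW] /setD1P[_ zW]; apply: iW.
  - move=> z /setD1P[zw zW]; apply/negP => az; case/eqP: zw.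
    exact/esym/(uniq_w w1 z).
  - move=> z /setU1P[->|/setD1P[zw zW]].
      by apply: tri aw1 _; rewrite coadj_sym.
    by apply/negP => az; case/eqP: zw; apply: uniq_w az aw2.
have subT : a1 |: (a2 |: W :\ w1) \subset Y.
  apply: subset_trans (subU a1 a2 pa1 pa2); do 2!apply: setUS.
  exact: subD1set.
have w1l : w1 \notin [:: a1; b1; a2; b2] by case/memW: w1W.
have nw p : p \in [:: a1; b1; a2; b2] -> p != w1.
  by move=> pl; apply: contraNneq w1l => <-.
have [w1A w1x xw1] := mem_far (proj1 (memW _ w1W)).
have [b1A b1x xb1] := mem_far (S _ pb1).
have [b2A b2x xb2] := mem_far (S _ pb2).
have cT : #|Y|.-2 <= #|a1 |: (a2 |: W :\ w1)|.+1.
  have h1 : a2 \notin W :\ w1 by rewrite in_setD1 (negPf (nW _ pa2)) andbF.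
  have h2 : a1 \notin a2 |: W :\ w1.
    by rewrite in_setU1 negb_or d13 in_setD1 (negPf (nW _ pa1)) andbF.
  rewrite !cardsU1 h1 h2 cW (cardsD1 w1 W) w1W.
  by move: #|_|; clear; lia.
have := seagull_model tri b12 _ _ _ _ _ (far_independent_model subT iT cT).
move=> /(_ w1) H; apply: (clique_modelW _ _ (H _ _ _ _ _)).
- rewrite subUset subA //= !subUset !sub1set b1A b2A w1A //.
- by rewrite cW; move: #|W|; clear; lia.
- by rewrite coadj_sym b1W.
- by rewrite coadj_sym b2W.
- by rewrite eq_sym nw.
- by rewrite eq_sym nw.
rewrite disjoint_sym disjoint_subset; apply/subsetP => z.
have notT p : p != x -> p != a1 -> p != a2 -> ~~ ((p != w1) && (p \in W)) ->
    p \notin x |: (a1 |: (a2 |: W :\ w1)).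
  by move=> px p1 p2 pW; rewrite !in_setU1 in_setD1 !negb_or px p1 p2.
move=> zl; rewrite inE; move: zl.
case/setUP=> [/set2P[]|/set1P]->; apply: notT => //.
- by rewrite eq_sym.
- by rewrite negb_and (nW _ pb1) orbT.
- by rewrite eq_sym.
- by rewrite eq_sym.
- by rewrite negb_and (nW _ pb2) orbT.
- by rewrite eq_sym nw.
- by rewrite eq_sym nw.
- by rewrite eqxx.
Qed.


(** Each of the two coedges has an end without coneighbours in the rest of Y, since otherwise it
    could be replaced by two coedges. Such an end is named second. *)
Lemma far_matching2_model :
  matchable (@coadj G) 2 Y -> ~~ matchable (@coadj G) 3 Y -> clique_model A #|Y|.-1.
Proof.
move=> M n3; have cY : 2.*2 + 0 <= #|Y| by rewrite addn0; apply: matchable_card M.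
have [l [ws [sl sws]]] := matching_list M cY.
case: l sl => [|[a1 b1] [|[a2 b2] []]] // _; case: ws sws => // _ U S /and3P[/= e1 e2 _].
have U4 : uniq [:: a1; b1; a2; b2] := U.
have S4 : {subset [:: a1; b1; a2; b2] <= Y} := S.
have free_end a b c d : perm_eq [:: a1; b1; a2; b2] [:: a; b; c; d] ->
    coadj a b -> coadj c d ->
    (forall w, w \in Y -> w \notin [:: a1; b1; a2; b2] -> ~~ coadj b w) \/
    (forall w, w \in Y -> w \notin [:: a1; b1; a2; b2] -> ~~ coadj a w).
  move=> p ab cd.
  have [w /and3P[wY wl aw]|na] :=
    pickP (fun w => [&& w \in Y, w \notin [:: a1; b1; a2; b2] & coadj a w]); last first.
    by right=> w wY wl; have := na w; rewrite wY wl => /= ->.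
  left=> w' w'Y w'l; apply/negP => bw'; case/negP: n3.
  have ww' : w != w' by apply: contraTneq aw => ->; apply: tri bw'.
  have p6 : perm_eq ([:: a1; b1; a2; b2] ++ [:: w; w']) [:: a; w; b; w'; c; d].
    by rewrite (perm_trans (y := [:: a; b; c; d] ++ [:: w; w'])) ?perm_cat //; perm_tac.
  apply: (@list_matchable _ _ _ [:: (a, w); (b, w'); (c, d)]).
  - rewrite -(perm_uniq p6) cat_uniq U4 /= (negPf wl) (negPf w'l) inE ww'.
    by [].
  - move=> z; rewrite -(perm_mem p6) mem_cat => /orP[/S4 //|].
    by rewrite in_cons mem_seq1 => /orP[]/eqP->.
  - by rewrite /= aw bw' cd.
have conclude a b c d : perm_eq [:: a1; b1; a2; b2] [:: a; b; c; d] ->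
    coadj a b -> coadj c d ->
    (forall w, w \in Y -> w \notin [:: a1; b1; a2; b2] -> ~~ coadj b w) ->
    (forall w, w \in Y -> w \notin [:: a1; b1; a2; b2] -> ~~ coadj d w) ->
    clique_model A #|Y|.-1.
  move=> p ab cd nb nd; apply: (@far_matching2_oriented a b c d) => //.
  - by rewrite -(perm_uniq p).
  - by move=> z; rewrite -(perm_mem p); apply: S4.
  - by move=> w wY; rewrite -(perm_mem p); apply: nb.
  - by move=> w wY; rewrite -(perm_mem p); apply: nd.
have e1' : coadj b1 a1 by rewrite coadj_sym.
have e2' : coadj b2 a2 by rewrite coadj_sym.
have p21 : perm_eq [:: a1; b1; a2; b2] [:: a2; b2; a1; b1] by perm_tac.
have [h1|h1] := free_end _ _ _ _ (perm_refl _) e1 e2;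
  have [h2|h2] := free_end _ _ _ _ p21 e2 e1.
- exact: (conclude a1 b1 a2 b2).
- by apply: (conclude a1 b1 b2 a2) => //; perm_tac.
- by apply: (conclude b1 a1 a2 b2) => //; perm_tac.
- by apply: (conclude b1 a1 b2 a2) => //; perm_tac.
Qed.

(* Two pairs that do not touch span a 4-cycle of the complement; an allowed pair lies on
   no such cycle unless it meets C, and C spans no coedge. *)
Let allowed : rel G := fun u v =>
  [|| [&& u \in C, v \in Y & ~~ coadj u v], [&& v \in C, u \in Y & ~~ coadj u v]
    | [&& u \in Y, v \in Y, u != v, ~~ coadj u v & #|nbr A u :&: nbr A v| <= 1]].

Let allowed_adj u v : allowed u v -> u -- v.
Proof.
have CY a y : a \in C -> y \in Y -> a != y.
  by move=> /mem_nbr[_ _ xa] /mem_far[_ _ xy]; apply: contraTneq xa => ->.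
case/or3P=> [/and3P[uC vY uv]|/and3P[vC uY uv]|/and5P[_ _ nuv uv _]].
- by apply: adj_of_coadjN (CY _ _ uC vY) uv.
- by apply: adj_of_coadjN uv; rewrite eq_sym CY.
- exact: adj_of_coadjN.
Qed.

Let allowed_far u v : allowed u v -> u \in Y \/ v \in Y.
Proof. by case/or3P=> [/and3P[]|/and3P[]|/and5P[]]; auto. Qed.

Let allowed_touch u v u' v' : u \in A -> v \in A -> u' \in A -> v' \in A ->
  allowed u v -> allowed u' v' -> touch [set u; v] [set u'; v'].
Proof.
move=> uA vA u'A v'A uv uv'; apply: contraT => /touchP nt.
have nadj p q : p \in [set u; v] -> q \in [set u'; v'] -> ~~ (p -- q).
  by move=> pP qP; apply/negP => pq; case: nt; exists p, q.
have co p q : p \in [set u; v] -> q \in [set u'; v'] -> coadj p q.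
  move=> pP qP; rewrite /coadj nadj // andbT; apply/negP => /eqP pq.
  case/set2P: (qP) => qE.
    have := nadj p v' pP; rewrite pq qE !inE eqxx orbT => /(_ isT).
    by rewrite allowed_adj.
  have := nadj p u' pP; rewrite pq qE !inE eqxx => /(_ isT).
  by rewrite sedge_sym allowed_adj.
have u_in : u \in [set u; v] by rewrite !inE eqxx.
have v_in : v \in [set u; v] by rewrite !inE eqxx orbT.
have u'_in : u' \in [set u'; v'] by rewrite !inE eqxx.
have v'_in : v' \in [set u'; v'] by rewrite !inE eqxx orbT.
(* Both [p'] and [q'] are common coneighbours of [p] and [q], which the third kind of allowed pair
   excludes; the other two kinds meet C. *)
have inC p q p' q' : p \in A -> q \in A -> p' \in A -> q' \in A ->
    allowed p q -> allowed p' q' -> coadj p p' -> coadj p q' -> coadj q p' -> coadj q q' ->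
    p \in C \/ q \in C.
  move=> pA qA p'A q'A pq pq' c1 c2 c3 c4.
  case/or3P: pq => [/and3P[]|/and3P[]|/and5P[_ _ _ _ cd]]; [by left|by right|].
  have np'q' : p' != q' by apply: contraTneq (allowed_adj pq') => ->; rewrite sedge_irrefl.
  have: [set p'; q'] \subset nbr A p :&: nbr A q.
    by rewrite subUset !sub1set !inE p'A q'A c1 c2 c3 c4.
  by move/subset_leq_card; rewrite cards2 np'q' leqNgt ltnS cd.
have [c1 c2 c3 c4] : [/\ coadj u u', coadj u v', coadj v u' & coadj v v'] by split; apply: co.
have [pC|pC] : u \in C \/ v \in C by apply: (inC u v u' v').
all: have [qC|qC] : u' \in C \/ v' \in C by
  apply: (inC u' v' u v) => //; rewrite coadj_sym.
all: by have := nbr_independent pC qC; rewrite ?c1 ?c2 ?c3 ?c4.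
Qed.

(** All vertices but [x] satisfy Dirac's condition for [allowed]; the perfect matching so obtained
    and the singleton of [x] are the branch sets. *)
Lemma far_large_model :
  D <= 4 -> 10 <= #|Y| -> odd #|A| -> clique_model A (uphalf #|A|).
Proof.
move=> D4 Y10 oA.
have cA := card_nbr_far xA.
have D_eq4 : D = 4.
  have := card_far_le; have := Y10; move: D4; clear.
  by move: #|Y| => m; case: D => [|[|[|[|[|]]]]] //=; lia.
have [p cB] : exists p, #|A :\ x| = p.*2.
  exists (#|A :\ x|)./2; rewrite even_halfK //.
  by move: oA; rewrite (cardsD1 x A) xA.
have cB' : p.*2 = 4 + #|Y|.
  by rewrite -cB; move: cA; rewrite (cardsD1 x A) xA D_eq4 => -[].
have deg u : u \in A :\ x -> p <= #|[set v in A :\ x | allowed u v]|.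
  case/setD1P=> ux uA; have [xu|nxu] := boolP (coadj x u).
    have uC : u \in C by rewrite inE uA.
    (* A vertex of C is allowed with all but at most 3 vertices of Y, and |Y| - 3 >= (|Y| + 4)/2 as
       |Y| >= 10. *)
    have sub : Y :\: [set y in Y | coadj u y] \subset [set v in A :\ x | allowed u v].
      apply/subsetP => y /setDP[yY]; rewrite inE yY /= => uy.
      have [yA yx _] := mem_far yY.
      by rewrite inE in_setD1 yx yA /allowed uC yY uy.
    have := subset_leq_card sub; rewrite cardsD.
    have -> : Y :&: [set y in Y | coadj u y] = [set y in Y | coadj u y].
      by apply/setIidPr/subsetP => y; rewrite inE => /andP[].
    have := deg_nbr xA uC; rewrite D_eq4; move: cB' Y10.
    by move: #|_| #|_| #|_|; clear; lia.
  have uY : u \in Y by rewrite inE uA ux.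
  set S := far A u; set codeg := fun v => #|[set a in nbr A u | coadj v a]|.
  (* These have two or more common coneighbours with [u]. If [u] has codegree d <= 4, then |S| = |Y|
     + 4 - d and |S| + |bad| <= 3d, so at least |S| - 1 - |bad| >= 2|Y| - 13 pairs at [u] are
     allowed; this is at least (|Y| + 4)/2 as |Y| >= 10. *)
  pose bad := [set v in S | 1 < codeg v].
  have xS : x \in S by rewrite inE xA eq_sym ux coadj_sym.
  have cS := card_nbr_far uA.
  have cbad : #|S| + #|bad| <= #|nbr A u| * 3.
    have := edges_nbr_far uA; rewrite D_eq4; apply: leq_trans.
    have -> : #|S| + #|bad| = \sum_(v in S) (1 + (1 < codeg v)).
      rewrite big_split /= sum1_card; congr (_ + _).
      rewrite -sum1_card big_mkcond [RHS]big_mkcond; apply: eq_bigr => v _.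
      by rewrite inE; case: (v \in S); case: (1 < codeg v).
    apply: leq_sum => v vS; have := nbr_meets_far uA vS; rewrite -/(codeg v).
    by case: (codeg v) => [|[|c]].
  have sub : (S :\ x) :\: bad \subset [set v in A :\ x | allowed u v].
    apply/subsetP => v /setDP[/setD1P[vx vS]]; rewrite [v \in bad]inE vS /= -leqNgt => cv.
    move: vS; rewrite [v \in S]inE => /and3P[vA vu uv].
    rewrite inE in_setD1 vx vA /=; have [xv|xv] := boolP (coadj x v).
      by rewrite /allowed [v \in C]inE vA xv uY uv orbT.
    have vY : v \in Y by rewrite inE vA vx.
    rewrite /allowed uY vY uv eq_sym vu /=.
    rewrite (_ : nbr A u :&: nbr A v = [set a in nbr A u | coadj v a]) ?cv ?orbT //.
    by apply/setP => a; rewrite !inE; case: (a \in A).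
  have := subset_leq_card sub; rewrite cardsD.
  have := subset_leq_card (subsetIr (S :\ x) bad).
  have dU := maxD uA; rewrite D_eq4 in dU.
  have cSx := cardsD1 x S; rewrite xS in cSx.
  move: cbad dU cS cA cSx cB' Y10; rewrite D_eq4 -/S.
  move: #|S| #|bad| #|nbr A u| #|_ :&: bad| #|[set v in _ | _]| #|Y| #|S :\ x| #|A|.
  by clear; lia.
have irr : irreflexive allowed.
  by move=> u; apply/negP => /allowed_adj; rewrite sedge_irrefl.
have M := matchable_ore cB deg irr.
have AxA u : u \in A :\ x -> u \in A by case/setD1P.
have [||Bs [sBs BsP pBs]] := matching_model _ _ M.
- by move=> u v _ _; apply: allowed_adj.
- by move=> u v u' v' /AxA ? /AxA ? /AxA ? /AxA ?; apply: allowed_touch.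
have -> : uphalf #|A| = p.+1.
  by rewrite (cardsD1 x A) xA cB add1n uphalfE -addn2 halfD odd_double andbF doubleK addn1.
exists ([set x] :: Bs); split; first by rewrite /= sBs.
- move=> P; rewrite inE => /orP[/eqP->|/BsP[u [v [/AxA uA /AxA vA uv ->]]]].
    rewrite sub1set; split=> //; last exact: set_connected1.
    by apply/set0Pn; exists x; rewrite inE.
  split; [by rewrite subUset !sub1set uA| |exact/set_connected2/allowed_adj].
  by apply/set0Pn; exists u; rewrite !inE eqxx.
- rewrite /= pBs andbT; apply/allP => P /BsP[u [v [/setD1P[ux uA] /setD1P[vx vA] uv ->]]].
  rewrite disjoints1 !inE ![x == _]eq_sym (negPf ux) (negPf vx) /=.
  (* Every allowed pair has an end in Y, to which [x] is adjacent in [G]. *)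
  apply/touchP; have [yY|yY] := allowed_far uv; [exists x, u|exists x, v].
    have [_ _ xy] := mem_far yY; rewrite !inE !eqxx; split=> //.
    by apply: adj_of_coadjN; rewrite // eq_sym.
  have [_ _ xy] := mem_far yY; rewrite !inE !eqxx orbT; split=> //.
  by apply: adj_of_coadjN; rewrite // eq_sym.
Qed.

(** As |A| = 1 + D + |Y| is odd, |Y| and D have the same parity. The cases |Y| <= D, |Y| = D + 2 and
    |Y| = D + 4 are settled by D + 1, D + 2 and D + 3 branch sets, from a packing or, if Y has small
    matching number, from a large clique in Y. *)
Lemma core_model : odd #|A| -> clique_model A (uphalf #|A|).
Proof.
move=> oA; have cA := card_nbr_far xA.
have [M1|n1] := boolP (matchable (@coadj G) 1 Y); last first.
  have iY : indep Y.
    move=> y z yY zY; apply/negP => yz; case/negP: n1.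
    have nyz : y != z by apply: contraTneq yz => ->; rewrite coadj_irr.
    exact: (matchable_add yz).
  have [le|lt] := leqP #|Y|.+1 D.
    apply: clique_modelW _ _ nbr_model; first by apply/subsetP => z /mem_nbr[].
    by rewrite cA; move: le; clear; lia.
  apply: clique_modelW (leqnn _) (far_independent_model (subxx Y) iY _).
    by rewrite subUset sub1set xA; apply/subsetP => z /mem_far[].
  by rewrite cA; move: lt; clear; lia.
case/matchableSP: (M1) => y [z [yY zY yz _]]; move: zY; rewrite in_setD1 => /andP[zy zY].
have D6 := max_deg_le6 yY zY yz.
have bd1 := card_far_le; have bd3 := card_far_le3.
have hp0 : has_pack (@coadj G) Y 0.
  exists [:: y; z]; split=> //; first by rewrite /= inE eq_sym zy.
  by apply/(@allP _ (mem Y)); rewrite /= yY zY.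
(* A far vertex has at least one and at least D - 3 of its at most D coneighbours in C. *)
have dY k : D <= k.+1 \/ (3 <= D /\ D <= 6 /\ k = 3) ->
    {in Y, forall v, #|[set w in Y | coadj v w]| <= k}.
  move=> Dk v vY; have := deg_far vY; have := nbr_meets_far xA vY.
  have := nbr_covers_far vY; move: Dk.
  by move: #|_| #|_| #|_|; clear; lia.
have oDY : odd #|Y| = odd D.
  by move: oA; rewrite cA /= oddD; case: (odd D); case: (odd #|Y|).
have [le|gt] := leqP #|Y| D.
  apply: clique_modelW (subxx _) _ (pack_far_model hp0).
  by rewrite cA; move: le; clear; lia.
have [le2|gt2] := leqP #|Y| D.+2.
  have mY : #|Y| = D.+2 by move: oDY gt le2; clear; lia.
  have kE : uphalf #|A| = D + 2 by rewrite cA mY; clear; lia.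
  rewrite kE.
  have [M2|n2] := boolP (matchable (@coadj G) 2 Y); last first.
    by rewrite addn2 -mY; apply: far_matching1_model.
  suff hp1 : has_pack (@coadj G) Y 1 by apply: pack_far_model.
  have D3 : 3 <= D.
    by move: bd1; rewrite mY; case: D => [|[|[|]]] //=; clear; lia.
  (* Excludes the 5-cycle when D = 3 and K_{3,3} when D = 4. *)
  have [v vY lowv] : exists2 v, v \in Y & #|[set w in Y | coadj v w]| < D.-1.
    by apply: low_degree_far; rewrite mY; move: D3; clear; lia.
  have [D_eq|D_gt] := eqVneq D 3.
    have [||//|reg] := has_pack1_5 (@coadj_sym G) tri _ _ M2.
    - by rewrite mY D_eq.
    - by apply: dY; rewrite D_eq; left.
    - by have := reg v vY; rewrite leqNgt; move: lowv; rewrite D_eq => ->.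
  have [||//|[c6 reg]] := has_pack1_6 (@coadj_sym G) tri _ _ M2.
  - by rewrite mY; move: D3 D_gt; clear; lia.
  - by apply: dY; right; move: D3 D6; clear; lia.
  - have := reg v vY; rewrite leqNgt; move: lowv.
    have -> : D = 4 by move: c6; rewrite mY; clear; lia.
    by move=> ->.
have [le4|gt4] := leqP #|Y| D.+4.
  have mY : #|Y| = D.+4 by move: oDY gt2 le4; clear; lia.
  have kE : uphalf #|A| = D + 3 by rewrite cA mY; clear; lia.
  rewrite kE.
  have [M3|n3] := boolP (matchable (@coadj G) 3 Y); last first.
    have [M2|n2] := boolP (matchable (@coadj G) 2 Y).
      by have := far_matching2_model M2 n3; rewrite mY addn3.
    apply: clique_modelW (subxx _) _ (far_matching1_model M1 n2).
    by rewrite mY addn3.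
  suff hp2 : has_pack (@coadj G) Y 2 by apply: pack_far_model.
  have D4 : 4 <= D.
    by move: bd1; rewrite mY; case: D => [|[|[|[|]]]] //=; clear; lia.
  apply: (has_pack2 (@coadj_sym G) tri _ _ M3).
    by apply: dY; right; move: D4 D6; clear; lia.
  by rewrite mY; move: D4; clear; lia.
(* Now |Y| >= D + 6 by parity; the bounds on |Y| leave only D = 4 and |Y| >= 10. *)
apply: far_large_model => //.
  move: bd1 bd3 gt4 D6 oDY; move: #|Y| => m; clear.
  by move: D => d; case: d => [|[|[|[|[|[|[|]]]]]]] //=; lia.
move: bd1 gt4 oDY; move: #|Y| => m; clear.
by move: D => d; case: d => [|[|[|[|d]]]] //=; lia.
Qed.

End Core.

(** * Reduction to codiameter two, and Gallai's lemma *)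

Section Models.
Variable G : sgraph.
Implicit Types (A : {set G}).
Hypothesis tri : forall x y z : G, coadj x y -> coadj y z -> ~~ coadj x z.
Hypothesis diff : forall u v w : G, coadj v w -> coadj w u ->
  #|[set a | coadj v a && ~~ coadj u a]| <= 3.

Lemma half_model A : clique_model A (uphalf #|A|).
Proof.
have [n] := ubnP #|A|; elim: n A => // n IHn A; rewrite ltnS => leAn.
have [->|/set0Pn[x0 x0A]] := eqVneq A set0; first by rewrite cards0; apply: clique_model0.
(* Dropping a vertex from a set of even size keeps the rounded-up half. *)
have [oA|eA] := boolP (odd #|A|); last first.
  have cA := cardsD1 x0 A; rewrite x0A in cA.
  apply: clique_modelW (subD1set A x0) _ (IHn (A :\ x0) _).
    by move: eA; rewrite cA; clear; lia.
  by move: leAn; rewrite cA; clear; lia.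
have [[y z] /= /and5P[yA zA yz nyz dom]|nodom] := pickP (fun p : G * G =>
  [&& p.1 \in A, p.2 \in A, p.1 != p.2, ~~ coadj p.1 p.2 &
      [forall w in A, ~~ (coadj p.1 w && coadj w p.2)]]).
  have zA' : z \in A :\ y by rewrite in_setD1 eq_sym yz.
  have cA : #|A| = #|A :\ y :\ z|.+2.
    by rewrite (cardsD1 y A) yA (cardsD1 z (A :\ y)) zA'.
  have lt : #|A :\ y :\ z| < n by move: leAn; rewrite cA; clear; lia.
  have [||||] := clique_model_add (A := A :\ y :\ z) (B := [set y; z]) _ _ _ _ (IHn _ lt).
  - rewrite disjoint_subset; apply/subsetP => w /setD1P[wz /setD1P[wy _]].
    by rewrite !inE negb_or wy wz.
  - by apply/set0Pn; exists y; rewrite !inE eqxx.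
  - exact/set_connected2/adj_of_coadjN.
  - move=> w /setD1P[wz /setD1P[wy wA]].
    have := forallP dom w; rewrite wA /= negb_and => /orP[nyw|nwz].
      exists y; first by rewrite !inE eqxx.
      by apply: adj_of_coadjN; rewrite // coadj_sym.
    by exists z; [rewrite !inE eqxx orbT|apply: adj_of_coadjN].
  move=> Bs BsP; apply: (clique_modelW _ _ (ex_intro _ Bs BsP)); last by rewrite cA.
  rewrite !subUset !sub1set yA zA /= !andbT.
  by apply: subset_trans (subD1set _ _) (subD1set _ _).
have [x xA maxx] := @arg_maxnP _ x0 (mem A) (fun y => #|nbr A y|) x0A.
apply: (@core_model G tri diff A x) => // y z yA zA yz nyz.
have := nodom (y, z); rewrite /= yA zA yz nyz /= => /negbT.
case/forallPn=> w; rewrite negb_imply negbK => /and3P[wA yw wz].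
by exists w.
Qed.

(* Gallai's lemma: if no vertex is needed by every maximum matching of the
   complement, then "no maximum matching misses both u and v" is an equivalence
   relation that contains the coedges.  Either a class is proper, and G[A] is a join,
   or maximum matchings miss at most one vertex. *)
Lemma matching_deficiency_model A :
  exists k, matchable (@coadj G) k A /\ clique_model A (#|A| - k).
Proof.
have [n] := ubnP #|A|; elim: n A => // n IHn A; rewrite ltnS => leAn.
have [k Mk nMk] := matchable_max (@coadj G) A.
(* If every maximum matching covers [v], then [k' < k] for the matching found without [v], and (|A|
   - 1) - k' >= |A| - k. *)
have [v /andP[vA nMv]|needless] := pickP (fun v => (v \in A) && ~~ matchable (@coadj G) k (A :\ v)).
  have cA := cardsD1 v A; rewrite vA in cA.
  have [|k' [Mk' mod']] := IHn (A :\ v); first by move: leAn; rewrite cA; clear; lia.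
  have k'k : k' < k by rewrite ltnNge; apply: contra nMv => /matchableW; apply.
  exists k; split=> //; apply: clique_modelW (subD1set A v) _ mod'.
  by move: k'k; rewrite cA; clear; lia.
have Mdel v : v \in A -> matchable (@coadj G) k (A :\ v).
  by move=> vA; have := needless v; rewrite vA => /negbFE.
have [[u w] /= /and4P[uA wA uw Muw]|nopair] := pickP (fun p : G * G =>
  [&& p.1 \in A, p.2 \in A, p.1 != p.2 & matchable (@coadj G) k (A :\ p.1 :\ p.2)]).
  (* The class of [u]: no maximum matching misses both [u] and another of its vertices. *)
  pose A1 := [set z in A | (z == u) || ~~ matchable (@coadj G) k (A :\ u :\ z)].
  pose A2 := A :\: A1.
  have uA1 : u \in A1 by rewrite inE uA eqxx.
  have wA2 : w \in A2 by rewrite inE wA andbT inE wA eq_sym (negPf uw) Muw.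
  have A1A : A1 \subset A by apply/subsetP => z; rewrite inE => /andP[].
  have A12 : A1 :|: A2 = A.
    apply/setP => z; rewrite in_setU in_setD.
    by have := subsetP A1A z; case: (z \in A1) => //= ->.
  have dA12 : [disjoint A1 & A2].
    by rewrite disjoint_sym disjoint_subset; apply/subsetP => z; rewrite inE => /andP[].
  have cA12 : #|A| = #|A1| + #|A2| by rewrite -{1}A12 cardsU disjoint_setI0 // cards0 subn0.
  have c1 : 0 < #|A1| by apply/card_gt0P; exists u.
  have c2 : 0 < #|A2| by apply/card_gt0P; exists w.
  have [|k1 [M1 mod1]] := IHn A1; first by move: leAn; rewrite cA12; move: c2; clear; lia.
  have [|k2 [M2 mod2]] := IHn A2; first by move: leAn; rewrite cA12; move: c1; clear; lia.
  have split12 z t : z \in A1 -> t \in A2 -> z -- t.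
    move=> zA1 tA2; have zt : z != t by apply: contraTneq zA1 => ->; rewrite (disjointFl dA12).
    apply: adj_of_coadjN zt _; apply/negP => czt.
    move: zA1 tA2; rewrite !inE => /andP[zA zP] /andP[]; rewrite negb_and => /orP[/negP//|].
    rewrite negb_or negbK => /andP[tu Mut] tA.
    have zt : z != t by apply: contraTneq czt => ->; rewrite coadj_irr.
    have nzt : ~~ matchable (@coadj G) k (A :\ z :\ t).
      by apply: contra nMk => M; apply: (matchable_add czt).
    case/orP: zP => [/eqP zu|nMz]; first by rewrite zu Mut in nzt.
    have uz : u != z by apply: contraTneq Mut => ->.
    (* Exchange gives a maximum matching that misses [z] and [u], against the choice of [A1], or one
       that misses [z] and [t], to which the coedge [zt] could be added. *)
    have [||M|M] := matchable_exchange (@coadj_sym G) uA tA zA uz _ _ Mut (Mdel z zA) nMk.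
    - by rewrite eq_sym.
    - by rewrite eq_sym.
    - by case/negP: nMz; apply: matchable_sub M; subset_tac.
    - by rewrite M in nzt.
  exists (k1 + k2); rewrite -{1 2}A12; split; first exact: matchableU.
  apply: clique_modelW (subxx _) _ (clique_modelU dA12 split12 mod1 mod2).
  have := matchable_card M1; have := matchable_card M2; rewrite cA12; clear; lia.
have [B [BA cB MB]] := matchable_exact Mk.
exists k; split=> //; apply: clique_modelW (subxx A) _ (half_model A).
(* With at most one uncovered vertex, |A| is 2k or 2k + 1, and |A| - k is its rounded-up half. *)
suff: #|A :\: B| <= 1 by rewrite cardsD (setIidPr BA) cB; clear; lia.
apply/card_le1_eqP => y z yD zD; apply/eqP/negPn/negP => yz.
rewrite eq_sym in yz; have := nopair (y, z); rewrite /= yz.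
move: yD zD => /setDP[yA yB] /setDP[zA zB]; rewrite yA zA /= => /negP[].
apply: matchable_sub MB; apply/subsetP => t tB; rewrite !inE (subsetP BA) // andbT.
by apply/andP; split; [apply: contraNneq zB|apply: contraNneq yB] => <-.
Qed.

End Models.

(** * Colourings from matchings of the complement *)

Lemma matchable_coloring (G : sgraph) k (A : {set G}) :
  matchable (@coadj G) k A ->
  exists f : G -> nat, {in A, forall x, f x < #|A| - k} /\
    {in A &, forall x y, x -- y -> f x != f y}.
Proof.
elim: k A => [|k IHk] A.
  exists (fun x => index x (enum A)); split=> [x xA|x y xA yA xy].
    by rewrite subn0 cardE index_mem mem_enum.
  apply: contraTneq xy => /(congr1 (nth x (enum A))).
  by rewrite !nth_index ?mem_enum // => ->; rewrite sedge_irrefl.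
move=> M; have leA := matchable_card M; move: M.
case/matchableSP=> u [v [uA vA uv /IHk[f [f_lt f_col]]]].
have cA : #|A| = #|A :\ u :\ v|.+2.
  by rewrite (cardsD1 u A) uA (cardsD1 v (A :\ u)) vA.
move: uv => /andP[nuv nadj].
(* The coadjacent [u] and [v] share the first colour that [f] leaves free on the other vertices. *)
pose g z := if z \in [set u; v] then #|A :\ u :\ v| - k else f z.
have memA z : z \in A -> z \notin [set u; v] -> z \in A :\ u :\ v.
  by move=> zA; rewrite !inE negb_or zA => /andP[-> ->].
exists g; rewrite /g; split=> [x xA|x y xA yA xy].
  case: ifPn => [_|/(memA _ xA)/f_lt]; move: leA; rewrite cA; clear; lia.
case: ifPn => xuv; case: ifPn => yuv.
- case/negP: nadj; move: xy; case/set2P: xuv => ->; case/set2P: yuv => ->;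
    rewrite ?sedge_irrefl //; by rewrite sedge_sym.
- by rewrite gtn_eqF //; apply: f_lt; apply: memA.
- by rewrite ltn_eqF //; apply: f_lt; apply: memA.
- by apply: f_col => //; apply: memA.
Qed.

Lemma matchable_colorable (G : sgraph) k :
  matchable (@coadj G) k [set: G] -> colorable G (#|G| - k).
Proof.
case/matchable_coloring=> f [f_lt f_col]; rewrite cardsT in f_lt.
apply/existsP; exists [ffun x => Ordinal (f_lt x (in_setT x))].
apply/forallP => x; apply/forallP => y; apply/implyP => xy; rewrite !ffunE.
exact: f_col.
Qed.

(** * The hypotheses read in the complement *)

Section ForbiddenSubgraphs.
Variable G : sgraph.
Hypothesis alpha_le2 : independence_number G <= 2.

Lemma coadj_triangle_free (x y z : G) : coadj x y -> coadj y z -> ~~ coadj x z.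
Proof.
move=> /andP[xy nxy] /andP[yz nyz]; apply/negP => /andP[xz nxz].
have: #|[set x; y; z]| <= independence_number G.
  apply: (@leq_bigmax_cond _ _ (fun S : {set G} => #|S|)).
  apply/forallP => a; apply/implyP => aS; apply/forallP => b; apply/implyP => bS.
  move: aS bS; rewrite !inE -!orbA => /or3P[]/eqP-> /or3P[]/eqP->;
    by rewrite ?sedge_irrefl // 1?sedge_sym.
rewrite leqNgt (leq_ltn_trans alpha_le2) //.
by rewrite setUC cardsU1 cards2 !inE negb_or ![z == _]eq_sym xz yz xy.
Qed.

Hypothesis H7_free : ~ exists S : {set G}, isomorphic (induced S) H7.

(** Four elements of the set would be the leaves of a star in the complement with centre [v] and a
    further leg [v], [w], [u]; together they induce [H7] in [G]. *)
Lemma coadj_diff_le3 (u v w : G) : coadj v w -> coadj w u ->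
  #|[set a | coadj v a && ~~ coadj u a]| <= 3.
Proof.
move=> vw wu; have tri := coadj_triangle_free.
rewrite leqNgt; apply/negP => big; apply: H7_free.
set S := [set a | _] in big.
have vu : ~~ coadj v u by apply: tri vw wu.
(* The hypotheses allow [u] and [v] to coincide, but then the set is empty. *)
have uv : u != v.
  apply: contraTneq big => uv; rewrite -leqNgt (_ : S = set0) ?cards0 //.
  by apply/setP => a; rewrite !inE uv andbN.
have [s [ss us sS]] : exists s : seq G, [/\ size s = 4, uniq s & {subset s <= S}].
  exists (take 4 (enum S)); split; first by rewrite size_takel // -cardE.
    by rewrite take_uniq // enum_uniq.
  by move=> a /mem_take; rewrite mem_enum.
have sP a : a \in s -> coadj v a /\ ~~ coadj u a by move/sS; rewrite inE => /andP.
have nadj (a b : G) : coadj a b -> a -- b = false by case/andP=> _ /negPf.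
have adj (a b : G) : a != b -> ~~ coadj a b -> a -- b = true by exact: adj_of_coadjN.
have ne (a b : G) : coadj a b -> a != b by case/andP.
case: s ss us sS sP => [|a [|b [|c [|d []]]]] // _ us _ sP.
have uw : coadj u w by rewrite coadj_sym.
have aP t : t \in [:: a; b; c; d] -> [/\ u -- t, v -- t = false & w -- t].
  move=> ts; have [vt ut] := sP t ts; split; last 1 first.
  - apply: adj; last by apply: tri vt; rewrite coadj_sym.
    by apply: contraNneq ut => <-.
  - by apply: adj => //; apply: contraNneq vu => ->.
  - exact: nadj.
have clique t t' : t \in [:: a; b; c; d] -> t' \in [:: a; b; c; d] -> t != t' -> t -- t'.
  move=> /sP[vt _] /sP[vt' _] tt'; apply: adj => //.
  by apply: tri vt'; rewrite coadj_sym.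
(* The order follows the numbering of the vertices of [H7]. *)
pose l := [:: u; a; b; c; d; v; w].
have ul : uniq l.
  have perm_l : perm_eq ([:: u; v; w] ++ [:: a; b; c; d]) l by perm_tac.
  have uvw : uniq [:: u; v; w] by rewrite /= !inE negb_or uv !ne.
  have sep : ~~ has (mem [:: u; v; w]) [:: a; b; c; d].
    apply/hasPn => t ts; rewrite /= !inE !negb_or.
    have [ut vt wt] := aP t ts; have [cvt _] := sP t ts.
    rewrite (eq_sym t v) (ne _ _ cvt); apply/and3P; split=> //.
      by apply: contraTneq ut => ->; rewrite sedge_irrefl.
    by apply: contraTneq wt => ->; rewrite sedge_irrefl.
  by rewrite -(perm_uniq perm_l) cat_uniq uvw sep us.
pose phi (i : H7) := nth u l (val i).
have phi_inj : injective phi.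
  by move=> i j /eqP; rewrite nth_uniq ?ltn_ord // => /eqP/val_inj.
have phi_adj (i j : H7) : phi i -- phi j = i -- j.
  have [ua va wa] : [/\ u -- a, v -- a = false & w -- a].
    by apply: aP; rewrite !inE eqxx.
  have [ub vb wb] : [/\ u -- b, v -- b = false & w -- b].
    by apply: aP; rewrite !inE eqxx orbT.
  have [uc vc wc] : [/\ u -- c, v -- c = false & w -- c].
    by apply: aP; rewrite !inE eqxx !orbT.
  have [ud vd wd] : [/\ u -- d, v -- d = false & w -- d].
    by apply: aP; rewrite !inE eqxx !orbT.
  move: us; rewrite /= !inE !negb_or -!andbA => /and5P[nab nac nad nbc /and3P[nbd ncd _]].
  have [ab ac ad] : [/\ a -- b, a -- c & a -- d].
    by split; apply: clique; rewrite // !inE eqxx ?orbT.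
  have [bc bd cd] : [/\ b -- c, b -- d & c -- d].
    by split; apply: clique; rewrite // !inE eqxx ?orbT.
  have uv' : u -- v by apply: adj; rewrite // coadj_sym.
  have uw' := nadj _ _ uw; have vw' := nadj _ _ vw.
  case: i j => [i ltiS] [j ltjS]; rewrite /phi /= /H7_rel -val_eqE /=.
  case: i {ltiS} (ltiS) => [|[|[|[|[|[|[|]]]]]]] // _;
    case: j {ltjS} (ltjS) => [|[|[|[|[|[|[|]]]]]]] //= _;
    first [by rewrite sedge_irrefl|assumption|by rewrite sedge_sym].
exists [set phi i | i : H7].
have mem_phi i : phi i \in [set phi i | i : H7] by apply: imset_f.
pose g (i : H7) : induced [set phi i | i : H7] := Sub (phi i) (mem_phi i).
have g_inj : injective g by move=> i j /(congr1 val)/phi_inj.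
have [|f gK fK] := inj_card_bij g_inj.
  by rewrite card_sig (eq_card (_ : _ =i [set phi i | i : H7])) // card_imset.
exists f; first by exists g.
by move=> y z; rewrite -{2}(fK y) -{2}(fK z) /= /induced_rel /= phi_adj.
Qed.

End ForbiddenSubgraphs.

(** * The colouring and the complete minor compared *)

Unset Implicit Arguments.

Theorem theorem3 (G : sgraph)
  (alpha_le2 : independence_number G <= 2)
  (H7_free : ~ exists S : {set G}, isomorphic (induced S) H7) :
  hadwiger_number G >= chromatic_number G.
Proof.
have tri := coadj_triangle_free alpha_le2.
have diff := coadj_diff_le3 alpha_le2 H7_free.
have [k [Mk mod_k]] := matching_deficiency_model tri diff [set: G].
have col := matchable_colorable Mk; rewrite cardsT in mod_k.
have minor_k := clique_model_minor mod_k.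
rewrite /hadwiger_number; case: ex_maxnP => h _ /(_ (#|G| - k)) le_h.
rewrite /chromatic_number; case: ex_minnP => c _ /(_ _ col) /leq_trans; apply.
by apply: le_h; apply/boolp.asboolP.
Qed.
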